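(* Let $r=\sqrt{d'}(\mathrm{Ad}_X\otimes\mathrm{Ad}_X)(r_{BD})$, where $d'\in F^*$ satisfies $\sqrt{d'}\notin K$, $X\in\mathrm{GL}(n,\overline F)$, and $r_{BD}$ is a Belavin--Drinfeld $r$-matrix over $\overline F$. If $\partial r$ defines a Lie bialgebra structure on $\mathfrak g=\mathfrak{su}(n,F,d)$, then the admissible triple $(\Gamma_1,\Gamma_2,\tau)$ associated to $r_{BD}$ is trivial, i.e. $\Gamma_1=\Gamma_2=\emptyset$.
   Context: $F$ is a field of characteristic zero, $d\in F^*\setminus {F^*}^2$, $K=F(\sqrt d)$, $\overline F$ an algebraic closure of $F$ containing $K$, $n$ a positive integer. For a matrix $A$ over $K$, $\overline A$ is obtained by applying the nontrivial element of $\mathrm{Gal}(K/F)$ to the entries. $\mathfrak{su}(n,F,d)=\{A\in\mathfrak{sl}(n,K):\overline A^T+A=0\}$, an $F$-Lie algebra with scalar extension $\mathfrak{sl}(n,\overline F)$ to $\overline F$. $\mathrm{Ad}_X(A)=XAX^{-1}$; $\partial r$ is the map $a\mapsto[r,a\otimes1+1\otimes a]$, and it defines a Lie bialgebra structure on $\mathfrak g$ if $[r,a\otimes1+1\otimes a]\in\mathfrak g\otimes_F\mathfrak g$ for all $a\in\mathfrak g$. For $r=\sum a_i\otimes b_i$, $r^{21}=\sum b_i\otimes a_i$. Belavin--Drinfeld $r$-matrices for $\mathfrak{sl}(n,\overline F)$: let $\mathfrak h$ be the diagonal Cartan subalgebra, $\Delta^+$ the positive roots with upper triangular root vectors, $\Gamma=\{\alpha_1,\dots,\alpha_{n-1}\}$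 the simple roots, $e_\alpha$ the root vectors given by the matrix units $E_{ij}$ ($i\ne j$), $\Omega$ the Casimir element with respect to the trace form, and $\Omega_0$ its component in $\mathfrak h\otimes\mathfrak h$. An admissible triple $(\Gamma_1,\Gamma_2,\tau)$ consists of $\Gamma_1,\Gamma_2\subseteq\Gamma$ and an isometric bijection $\tau:\Gamma_1\to\Gamma_2$ such that for each $\alpha\in\Gamma_1$ some $\tau^k(\alpha)\notin\Gamma_1$. A Belavin--Drinfeld $r$-matrix associated to it is $r_{BD}=r_0+r_1$ with $r_0\in\mathfrak h\otimes\mathfrak h$, $r_0+r_0^{21}=\Omega_0$, $(\tau(\alpha)\otimes\mathrm{Id}+\mathrm{Id}\otimes\alpha)(r_0)=0$ for all $\alpha\in\Gamma_1$, and $r_1=\sum_{\alpha\in\Delta^+}e_\alpha\otimes e_{-\alpha}+\sum_{\alpha\in\mathrm{Span}(\Gamma_1)^+}\sum_{k\ge1}e_\alpha\wedge e_{-\tau^k(\alpha)}$, where $a\wedge b=a\otimes b-b\otimes a$, $\mathrm{Span}(\Gamma_1)^+$ is the set of positive roots in the span of $\Gamma_1$, the sum is over those $k$ for which $\tau^k(\alpha)$ is defined, and $e_{-\tau^k(\alpha)}$ means $\theta^k(e_{-\alpha})$, $\theta$ being the Lie algebra isomorphism (between the subalgebras generated by the $e_{\pm\alpha}$ with $\alpha\in\Gamma_1$, resp. $\Gamma_2$) with $e_{\pm\alpha}\mapsto e_{\pm\tau(\alpha)}$ for $\alpha\in\Gamma_1$. *)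

(* Defs.v *)
From HB Require Import structures.
From mathcomp Require Import all_boot all_order all_fingroup all_algebra all_field.
From mathcomp Require Export mxtens.

Set Implicit Arguments.
Unset Strict Implicit.
Unset Printing Implicit Defensive.

Import GRing.Theory.
Local Open Scope ring_scope.

(* The tensor square of 'M[L]_n is 'M[L]_(n * n), with the Kronecker product
   A *t B as pure tensor; matrix multiplication is then the product of the
   tensor square of the associative algebra 'M[L]_n (tensmx_mul). *)

Section TensorSquare.
Variables (L : fieldType) (n : nat).
Implicit Types (A B : 'M[L]_n) (r : 'M[L]_(n * n)).

(* The linear extension of a bilinear map f along (A, B) |-> A *t B. *)
Definition tlift (V : lmodType L) (f : 'M[L]_n -> 'M[L]_n -> V) r : V :=
  \sum_i \sum_j \sum_k \sum_l
     r (mxtens_index (i, k)) (mxtens_index (j, l)) *: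
     f (delta_mx i j) (delta_mx k l).

Lemma tlift_tens (V : lmodType L) (f : 'M[L]_n -> 'M[L]_n -> V) A B :
  (forall C, linear (f C)) -> (forall C, linear (f^~ C)) ->
  tlift f (A *t B) = f A B.
Proof.
move=> fr fl.
have sumr C (I : finType) (c : I -> L) (D : I -> 'M[L]_n) :
    f C (\sum_i c i *: D i) = \sum_i c i *: f C (D i).
  pose g := GRing.isLinear.Build _ _ _ _ (f C) (fr C).
  pose h : {linear 'M[L]_n -> V} := HB.pack (f C) g.
  by rewrite -[f C]/(h : _ -> _) linear_sum; apply: eq_bigr => i _; rewrite linearZ.
have suml C (I : finType) (c : I -> L) (D : I -> 'M[L]_n) :
    f (\sum_i c i *: D i) C = \sum_i c i *: f (D i) C.
  pose g := GRing.isLinear.Build _ _ _ _ (f^~ C) (fl C).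
  pose h : {linear 'M[L]_n -> V} := HB.pack (f^~ C) g.
  rewrite -[f _ C]/(h _) linear_sum; apply: eq_bigr => i _; by rewrite linearZ.
have dec (C : 'M[L]_n) : C = \sum_(p : 'I_n * 'I_n) C p.1 p.2 *: delta_mx p.1 p.2.
  by rewrite [LHS]matrix_sum_delta pair_big.
rewrite {2}(dec A) suml -(pair_big predT predT
  (fun i j => A i j *: f (delta_mx i j) B)) /tlift.
apply: eq_bigr => i _; apply: eq_bigr => j _.
rewrite {2}(dec B) sumr scaler_sumr -(pair_big predT predT
  (fun k l => A i j *: (B k l *: f (delta_mx i j) (delta_mx k l)))).
by apply: eq_bigr => k _; apply: eq_bigr => l _; rewrite tensmxE scalerA.
Qed.

(* The image of V (x) V in the tensor square of 'M[L]_n.  It is used for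
   L-subspaces V and for F-subspaces V whose F-independent vectors stay
   independent over L; in the latter case (x) is taken over F. *)
Definition in_tensor (V : 'M[L]_n -> Prop) r : Prop :=
  exists (m : nat) (a b : 'I_m -> 'M[L]_n),
    [/\ forall i, V (a i), forall i, V (b i) & r = \sum_(i < m) a i *t b i].

Definition flip r : 'M[L]_(n * n) := tlift (fun A B => B *t A) r.

Definition wedge A B : 'M[L]_(n * n) := A *t B - B *t A.

Definition lie (N : nat) (A B : 'M[L]_N) : 'M[L]_N := A *m B - B *m A.

Definition coboundary r A : 'M[L]_(n * n) :=
  lie r (A *t 1%:M + 1%:M *t A).

Definition coboundary_bialgebra (g : 'M[L]_n -> Prop) r : Prop :=
  forall A, g A -> in_tensor g (coboundary r A).

Definition Ad (X A : 'M[L]_n) : 'M[L]_n := X *m A *m invmx X.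

Definition Ad2 (X : 'M[L]_n) r : 'M[L]_(n * n) :=
  tlift (fun A B => Ad X A *t Ad X B) r.

Definition sl A : Prop := \tr A = 0.

Definition cartan A : Prop := is_diag_mx A /\ \tr A = 0.

Definition traceless A : 'M[L]_n := A - (\tr A / n%:R)%:M.

Definition diag_part A : 'M[L]_n := \matrix_(i, j) (A i j *+ (i == j)).

(* casimir_in and casimir_dual characterize this as the Casimir element of
   sl_n for the trace form. *)
Definition casimir : 'M[L]_(n * n) :=
  \sum_i \sum_j traceless (delta_mx i j) *t traceless (delta_mx j i).

Definition casimir0 : 'M[L]_(n * n) :=
  tlift (fun A B => diag_part A *t diag_part B) casimir.

Lemma tr_traceless A : n%:R != 0 :> L -> sl (traceless A).
Proof.
move=> n0; rewrite /sl linearB /= mxtrace_scalar -[_ *+ n]mulr_natr.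
by rewrite divfK // subrr.
Qed.

Lemma casimir_in : n%:R != 0 :> L -> in_tensor sl casimir.
Proof.
move=> n0; rewrite /casimir pair_big /=.
exists #|{: 'I_n * 'I_n}|,
  (fun p => traceless (delta_mx (enum_val p).1 (enum_val p).2)),
  (fun p => traceless (delta_mx (enum_val p).2 (enum_val p).1)).
split=> [p|p|]; [exact: tr_traceless|exact: tr_traceless|].
rewrite (reindex (enum_val (A := {: 'I_n * 'I_n}))) //=.
exact/onW_bij/enum_val_bij.
Qed.

Lemma casimir_dual A : sl A ->
  tlift (fun B C => \tr (A *m B) *: C) casimir = A.
Proof.
move=> trA.
have tD (V : lmodType L) (f : 'M[L]_n -> 'M[L]_n -> V) (I : finType) (R : I -> 'M[L]_(n * n)) :
    tlift f (\sum_p R p) = \sum_p tlift f (R p).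
  rewrite /tlift [RHS]exchange_big; apply: eq_bigr => i _.
  rewrite [RHS]exchange_big; apply: eq_bigr => j _.
  rewrite [RHS]exchange_big; apply: eq_bigr => k _.
  rewrite [RHS]exchange_big; apply: eq_bigr => l _.
  by rewrite summxE scaler_suml.
rewrite /casimir pair_big /= tD -(pair_big predT predT (fun i j => tlift _
  (traceless (delta_mx i j) *t traceless (delta_mx j i)))) /=.
have trE i j : \tr (A *m traceless (delta_mx i j)) = A j i.
  rewrite /traceless mulmxBr linearB /= mul_mx_scalar linearZ /= trA mulr0 subr0.
  rewrite mxtrace_mulC /mxtrace (bigD1 i) //= big1 => [|k ki].
    rewrite addr0 mxE (bigD1 j) //= big1 => [|k kj]; first by rewrite mxE !eqxx mul1r addr0.
    by rewrite mxE (negPf kj) andbF mul0r.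
  by rewrite mxE big1 // => l _; rewrite mxE (negPf ki) mul0r.
transitivity (\sum_i \sum_j A j i *: traceless (delta_mx j i)).
  apply: eq_bigr => i _; apply: eq_bigr => j _.
  rewrite tlift_tens ?trE // => C x u v /=.
    by rewrite scalerDr !scalerA [_ * x]mulrC.
  by rewrite mulmxDr -scalemxAr linearD linearZ /= scalerDl scalerA.
rewrite exchange_big /= [RHS](matrix_sum_delta A).
have -> : \sum_j \sum_i A j i *: traceless (delta_mx j i) =
   \sum_j \sum_i A j i *: delta_mx j i -
   (\sum_j \sum_i A j i * (\tr (delta_mx j i : 'M[L]_n) / n%:R))%:M.
  rewrite raddf_sum -sumrB; apply: eq_bigr => j _.
  rewrite raddf_sum -sumrB; apply: eq_bigr => i _.
  by rewrite scalerBr scale_scalar_mx.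
suff -> : \sum_j \sum_i A j i * (\tr (delta_mx j i : 'M[L]_n) / n%:R) = 0.
  by rewrite raddf0 subr0.
under eq_bigr do under eq_bigr do rewrite mulrA.
under eq_bigr do rewrite -mulr_suml.
rewrite -mulr_suml; suff -> : \sum_j \sum_i A j i * \tr (delta_mx j i : 'M[L]_n) = \tr A.
  by rewrite trA mul0r.
rewrite {2}(matrix_sum_delta A) linear_sum; apply: eq_bigr => j _.
by rewrite linear_sum; apply: eq_bigr => i _; rewrite linearZ.
Qed.

End TensorSquare.

Section BelavinDrinfeld.
Variables (L : fieldType) (n : nat).

(* Weights are row vectors: v stands for A |-> \sum_i v_i A_ii on the diagonal
   matrices.  The form dual to the trace form is the dot product on the span
   of the roots. *)

Definition weight_eval (v : 'rV[L]_n) (A : 'M[L]_n) : L :=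
  \sum_i v 0 i * A i i.

Definition wdot (u v : 'rV[L]_n) : L := \sum_i u 0 i * v 0 i.

Definition root (i j : 'I_n) : 'rV[L]_n := delta_mx 0 i - delta_mx 0 j.

(* The set of simple roots is indexed by 'I_n.-1: k (counted from 0) stands
   for eps_k - eps_(k+1). *)
Definition slo (k : 'I_n.-1) : 'I_n := widen_ord (leq_pred n) k.

Fact shi_subproof (k : 'I_n.-1) : (k.+1 < n)%N.
Proof. by case: n k => [|m] [k]. Qed.

Definition shi (k : 'I_n.-1) : 'I_n := Ordinal (shi_subproof k).

Definition simple_root (k : 'I_n.-1) : 'rV[L]_n := root (slo k) (shi k).

Definition root_span (G : {set 'I_n.-1}) : {vspace 'rV[L]_n} :=
  <<[seq simple_root k | k in G]>>%VS.

Variables (G1 G2 : {set 'I_n.-1}) (tau : 'I_n.-1 -> 'I_n.-1).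

(* Only the values of tau on G1 matter.  In adm_nilp the first iterate that
   leaves G1 is an iterate of the partial map. *)
Record admissible : Prop := Admissible {
  adm_inj : {in G1 &, injective tau};
  adm_img : tau @: G1 = G2;
  adm_isom : {in G1 &, forall a b,
    wdot (simple_root (tau a)) (simple_root (tau b)) =
    wdot (simple_root a) (simple_root b)};
  adm_nilp : forall a, a \in G1 -> exists k, iter k tau a \notin G1
}.

(* The linear extension of tau to the span of G1; it also has a junk value
   elsewhere. *)
Definition tau_lin (v : 'rV[L]_n) : 'rV[L]_n :=
  \sum_(a in G1) coord [tuple simple_root b | b < n.-1] a v *:
                 simple_root (tau a).

Definition tau_pow_defined (k : nat) (v : 'rV[L]_n) : bool :=
  [forall m : 'I_k, iter m tau_lin v \in root_span G1].

Inductive lie_gen (S : 'M[L]_n -> Prop) : 'M[L]_n -> Prop :=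
| lie_gen_in A of S A : lie_gen S A
| lie_gen0 : lie_gen S 0
| lie_gen_lin c A B of lie_gen S A & lie_gen S B : lie_gen S (c *: A + B)
| lie_gen_lie A B of lie_gen S A & lie_gen S B : lie_gen S (lie A B).

Definition e_pos (k : 'I_n.-1) : 'M[L]_n := delta_mx (slo k) (shi k).
Definition e_neg (k : 'I_n.-1) : 'M[L]_n := delta_mx (shi k) (slo k).

Definition simple_subalg (G : {set 'I_n.-1}) : 'M[L]_n -> Prop :=
  lie_gen (fun A => exists2 k, k \in G & A = e_pos k \/ A = e_neg k).

(* These conditions determine theta on simple_subalg G1; its values elsewhere are
   never used. *)
Record BD_iso (theta : 'M[L]_n -> 'M[L]_n) : Prop := BDIso {
  theta_lin : forall c A B, simple_subalg G1 A -> simple_subalg G1 B ->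
    theta (c *: A + B) = c *: theta A + theta B;
  theta_lie : forall A B, simple_subalg G1 A -> simple_subalg G1 B ->
    theta (lie A B) = lie (theta A) (theta B);
  theta_inj : forall A B, simple_subalg G1 A -> simple_subalg G1 B -> theta A = theta B -> A = B;
  theta_img : forall B, simple_subalg G2 B <-> exists2 A, simple_subalg G1 A & B = theta A;
  theta_pos : forall k, k \in G1 -> theta (e_pos k) = e_pos (tau k);
  theta_neg : forall k, k \in G1 -> theta (e_neg k) = e_neg (tau k)
}.

(* tau^k is defined on a root only if k <= #|G1| < n, because tau is injective
   and nilpotent on G1; so the range of k below loses no term. *)
Definition BD_r1 (theta : 'M[L]_n -> 'M[L]_n) : 'M[L]_(n * n) :=
  \sum_(i < n) \sum_(j < n | (i < j)%N) delta_mx i j *t delta_mx j i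
  + \sum_(i < n) \sum_(j < n | (i < j)%N && (root i j \in root_span G1))
      \sum_(1 <= k < n | tau_pow_defined k (root i j))
        wedge (delta_mx i j) (iter k theta (delta_mx j i)).

Record BD_r0 (r0 : 'M[L]_(n * n)) : Prop := BDr0 {
  r0_cartan : in_tensor (@cartan L n) r0;
  r0_sym : r0 + flip r0 = casimir0 L n;
  r0_tau : forall a, a \in G1 ->
    tlift (fun A B => weight_eval (simple_root (tau a)) A *: B
                      + weight_eval (simple_root a) B *: A) r0 = 0
}.

Definition BD_rmatrix (r : 'M[L]_(n * n)) : Prop :=
  admissible /\
  exists r0 theta, [/\ BD_r0 r0, BD_iso theta & r = r0 + BD_r1 theta].

End BelavinDrinfeld.

Section SpecialUnitary.
Variables (F : fieldType) (K : splittingFieldType F) (sigma : gal_of {:K}) (n : nat).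

Definition su (A : 'M[K]_n) : Prop :=
  \tr A = 0 /\ (map_mx sigma A)^T + A = 0.

(* The copy of su inside the matrices over an extension L of K. *)
Definition su_in (L : fieldType) (iota : {rmorphism K -> L}) (A : 'M[L]_n) : Prop :=
  exists2 B : 'M[K]_n, su B & A = map_mx iota B.

End SpecialUnitary.

(* Main.v *)
From HB Require Import structures.
Require Import Defs.
From mathcomp Require Import all_boot all_order all_algebra all_fingroup all_field.
From mathcomp Require Import zify.
From Stdlib Require Import Classical.
Set Implicit Arguments.
Unset Strict Implicit.
Unset Printing Implicit Defensive.
Import GRing.Theory.
Local Open Scope ring_scope.

(* Let [j] be an isomorphism between subfields of [Fbar] that restricts to the
   conjugation of [K], sends [sqrt d'] to [- sqrt d'], and is defined on the
   entries of [X] and of [r_BD].  The conjugation of [su] is [A |-> - j(A)^T], so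
   for [r = sqrt d' M] the bialgebra condition says that [j(r) - r^T] commutes
   with [sl].  Its skew part is then an invariant of [Lambda^2 sl], hence zero,
   and the symmetric parts are multiples of the Casimir element; this gives
   [j(M) = (M^21)^T].
   A member of the standard flag cut off at the simple root [t] is preserved by
   the right legs of [r_BD] if [t] is not in [Gamma_1], and is the only subspace
   of its dimension that the left legs can preserve, which they do only if [t] is
   not in [Gamma_2].  By the equation above, [j] followed by taking annihilators
   turns a subspace preserved by the right legs of [M] into one preserved by the
   left legs, so [Gamma_2] is contained in [Gamma_1].  Both have the same
   cardinality, so [tau] permutes [Gamma_1], and by nilpotency it is empty. *)

(** * Embeddings of subfields *)

(** By minimality every polynomial that kills [x] through [i] is a multiple of [p], hence kills [y]
    through [j]. So evaluation at [y] is well defined on the field generated by [x]. *)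
Lemma adjoin_root (S L : fieldType) (i j : {rmorphism S -> L}) (x y : L)
    (p : {poly S}) :
  p != 0 -> root (map_poly i p) x -> root (map_poly j p) y ->
  (forall q, q != 0 -> root (map_poly i q) x -> (size p <= size q)%N) ->
  exists (S' : fieldType) (k : {rmorphism S -> S'})
    (i' j' : {rmorphism S' -> L}),
  [/\ i' \o k =1 i, j' \o k =1 j & exists2 v, i' v = x & j' v = y].
Proof.
move=> p0 px py pmin.
have trans q : (map_poly i q).[x] = 0 -> (map_poly j q).[y] = 0.
  move=> qx; have: q %% p = 0.
    apply/eqP/negPn/negP => r0.
    have := pmin _ r0; rewrite leqNgt ltn_modp p0 => /(_ _)/notF; apply.
    move: qx; rewrite /root {1}(divp_eq q p) rmorphD rmorphM hornerD hornerM /=.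
    by rewrite (rootP px) mulr0 add0r => ->.
  rewrite {2}(divp_eq q p) => ->.
  by rewrite addr0 rmorphM hornerM (rootP py) mulr0.
pose S' := subFExtend i x p.
pose rep (v : S') := sval (sig_eqW (subfxE v)).
have repE v : v = subfx_eval i x p (rep v) by rewrite /rep; case: sig_eqW.
(* [f] evaluates a chosen representative at [y]; [fE] shows that the choice is immaterial. *)
pose f v := (map_poly j (rep v)).[y].
have fE v q : v = subfx_eval i x p q -> f v = (map_poly j q).[y].
  rewrite {1}(repE v) => /(congr1 (@subfx_inj _ _ i x p)).
  rewrite !(subfx_inj_eval px p0) => vq; apply/eqP; rewrite -subr_eq0.
  by rewrite -hornerN -hornerD -!rmorphN -rmorphD trans // rmorphB hornerD hornerN vq subrr.
have fB : zmod_morphism f.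
  move=> u v; rewrite (fE (u - v) (rep u - rep v)).
    by rewrite rmorphB hornerD hornerN.
  by rewrite rmorphB [LHS]/= {1}(repE u) {1}(repE v).
have fM : monoid_morphism f.
  split; first by rewrite (fE _ 1) ?rmorph1 ?hornerC.
  move=> u v; rewrite (fE (u * v) (rep u * rep v)).
    by rewrite rmorphM hornerM.
  by rewrite rmorphM [LHS]/= {1}(repE u) {1}(repE v).
pose fB' := GRing.isZmodMorphism.Build _ _ f fB.
pose fM' := GRing.isMonoidMorphism.Build _ _ f fM.
pose j' : {rmorphism S' -> L} := HB.pack f fB' fM'.
exists S', (@inj_subfx _ _ i x p), (@subfx_inj _ _ i x p), j'; split=> [u|u|].
- by rewrite /= subfx_inj_eval // map_polyC hornerC.
- by rewrite /= (fE _ u%:P) // map_polyC hornerC.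
- exists (subfx_root i x p); first exact: subfx_inj_root.
  by rewrite /= (fE _ 'X) // map_polyX hornerX.
Qed.

(** Strong induction on the size, with excluded middle deciding whether a smaller annihilator
    exists. *)
Lemma minimal_annihilator (S L : fieldType) (i : {rmorphism S -> L}) (x : L) :
  algebraicOver i x ->
  exists p : {poly S}, [/\ p != 0, root (map_poly i p) x &
    forall q, q != 0 -> root (map_poly i q) x -> (size p <= size q)%N].
Proof.
case=> p; have [N] := ubnP (size p); elim: N p => // N IH p pN p0 px.
case: (classic (exists q, [/\ q != 0, root (map_poly i q) x & (size q < size p)%N])).
  by case=> q [q0 qx qp]; apply: (IH q) => //; apply: leq_trans qp pN.
move=> pmin; exists p; split=> // q q0 qx; rewrite leqNgt; apply/negP => qp.
by case: pmin; exists q.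
Qed.

(* The finite steps of extending an isomorphism between subfields of an
   algebraically closed field; [i'] is the inclusion, [j'] the isomorphism. *)
Lemma extend_embedding (L : closedFieldType) (xs : seq L) (S : fieldType)
    (i j : {rmorphism S -> L}) :
  (forall x, algebraicOver i x) ->
  exists (S' : fieldType) (k : {rmorphism S -> S'})
    (i' j' : {rmorphism S' -> L}),
  [/\ i' \o k =1 i, j' \o k =1 j & {in xs, forall x, exists v, i' v = x}].
Proof.
elim: xs S i j => [|x xs IH] S i j alg.
  by exists S, idfun, i, j; split.
have [p [p0 px pmin]] := minimal_annihilator (alg x).
(* [j] preserves the degree of [p], which is positive because [p] is nonzero and has the root [x]
   through [i]. *)
have /closed_rootP[y py] : size (map_poly j p) != 1.
  rewrite size_map_poly -(size_map_poly i).
  by rewrite gtn_eqF // (root_size_gt1 _ px) // map_poly_eq0.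
have [S1 [k1 [i1 [j1 [ik1 jk1 [v i1v j1v]]]]]] := adjoin_root p0 px py pmin.
have [|S2 [k2 [i2 [j2 [ik2 jk2 im2]]]]] := IH S1 i1 j1.
  move=> z; have [q q0 qz] := alg z; exists (map_poly k1 q).
    by rewrite map_poly_eq0.
  by rewrite -map_poly_comp (eq_map_poly ik1).
exists S2, (k2 \o k1), i2, j2; split=> [u|u|z].
- by rewrite -ik1 -[LHS]/((i2 \o k2) (k1 u)) ik2.
- by rewrite -jk1 -[LHS]/((j2 \o k2) (k1 u)) jk2.
rewrite inE => /predU1P[->|/im2//]; exists (k2 v).
by rewrite -i1v; apply: ik2.
Qed.

Lemma mx_preimage (S L : fieldType) (i : {rmorphism S -> L}) m n (A : 'M[L]_(m, n)) :
  (forall a b, exists v, i v = A a b) -> exists B, A = map_mx i B.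
Proof.
move=> im; have im' a b : exists v, i v == A a b.
  by have [v <-] := im a b; exists v.
exists (\matrix_(a, b) xchoose (im' a b)); apply/matrixP => a b.
by rewrite !mxE; apply/esym/eqP/(xchooseP (im' a b)).
Qed.

(** A linear polynomial over [K] has its root in [K]. This makes $X^2-d'$ minimal for
    $\sqrt{d'}$. *)
Lemma size_minpoly_sqrt (K L : fieldType) (iota : {rmorphism K -> L}) (s : L)
    (q : {poly K}) :
  (forall y, iota y != s) -> q != 0 -> root (map_poly iota q) s ->
  (2 < size q)%N.
Proof.
move=> sK q0 qs; rewrite ltnNge; apply/negP => sq.
have: (1 < size q)%N.
  by rewrite -(size_map_poly iota) (root_size_gt1 _ qs) // map_poly_eq0.
move=> sq1; have {sq1}sq : size q = 2%N by apply/eqP; rewrite eqn_leq sq.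
have q1 : q`_1 != 0 by rewrite -[1%N]/(2.-1) -sq lead_coef_eq0.
move: qs; rewrite /root horner_coef size_map_poly sq big_ord_recl big_ord1 /=.
rewrite !coef_map /= expr0 mulr1 expr1 addrC addr_eq0 => /eqP e.
case/eqP: (sK (- q`_0 / q`_1)); rewrite rmorphM rmorphN fmorphV /= -e.
by rewrite mulrC mulKf // fmorph_eq0.
Qed.

(** * The tensor square of a matrix algebra *)

Section Tensor.
Variable R : comNzRingType.

Lemma tensmxDl m n p q (A B : 'M[R]_(m, n)) (C : 'M[R]_(p, q)) :
  (A + B) *t C = A *t C + B *t C.
Proof. by apply/matrixP=> a b; rewrite !mxE mulrDl. Qed.

Lemma tensmxDr m n p q (A B : 'M[R]_(m, n)) (C : 'M[R]_(p, q)) :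
  C *t (A + B) = C *t A + C *t B.
Proof. by apply/matrixP=> a b; rewrite !mxE mulrDr. Qed.

Lemma tensmxZl m n p q c (A : 'M[R]_(m, n)) (C : 'M[R]_(p, q)) :
  (c *: A) *t C = c *: (A *t C).
Proof. by apply/matrixP=> a b; rewrite !mxE mulrA. Qed.

Lemma tensmxZr m n p q c (A : 'M[R]_(m, n)) (C : 'M[R]_(p, q)) :
  C *t (c *: A) = c *: (C *t A).
Proof. by apply/matrixP=> a b; rewrite !mxE mulrCA. Qed.

Lemma tensmx_suml m n p q I (s : seq I) (F : I -> 'M[R]_(m, n)) (C : 'M[R]_(p, q)) :
  (\sum_(i <- s) F i) *t C = \sum_(i <- s) F i *t C.
Proof.
by elim/big_rec2: _ => [|i _ A _ <-]; rewrite ?tens0mx ?tensmxDl.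
Qed.

Lemma tensmx_sumr m n p q I (s : seq I) (F : I -> 'M[R]_(m, n)) (C : 'M[R]_(p, q)) :
  C *t (\sum_(i <- s) F i) = \sum_(i <- s) C *t F i.
Proof.
by elim/big_rec2: _ => [|i _ A _ <-]; rewrite ?tensmx0 ?tensmxDr.
Qed.

Lemma tensmx11 m n : (1%:M : 'M[R]_m) *t (1%:M : 'M[R]_n) = 1%:M.
Proof.
apply/matrixP=> u v; case: (mxtens_indexP u) => i k; case: (mxtens_indexP v) => j l.
rewrite tensmxE !mxE -natrM mulnb (can_eq (@mxtens_indexK m n)).
by rewrite xpair_eqE.
Qed.

Lemma delta_mx_tens m n p q i j k l :
  delta_mx i j *t delta_mx k l =
  delta_mx (mxtens_index (i, k)) (mxtens_index (j, l)) :> 'M[R]_(m * p, n * q).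
Proof.
apply/matrixP=> u v; case: (mxtens_indexP u) => a c; case: (mxtens_indexP v) => b d.
rewrite tensmxE !mxE -natrM mulnb !(can_eq (@mxtens_indexK _ _)) !xpair_eqE.
by rewrite andbACA.
Qed.

Lemma sum_mxtens n (V : nmodType) (F : 'I_(n * n) -> V) :
  \sum_u F u = \sum_i \sum_k F (mxtens_index (i, k)).
Proof.
rewrite pair_big /= (reindex (@mxtens_index n n)); first by apply: eq_bigr => -[].
by exists (@mxtens_unindex n n) => u _; rewrite ?mxtens_indexK ?mxtens_unindexK.
Qed.

Lemma mxtens_sum_delta n (r : 'M[R]_(n * n)) :
  r = \sum_i \sum_j \sum_k \sum_l
     r (mxtens_index (i, k)) (mxtens_index (j, l)) *:
     (delta_mx i j *t delta_mx k l).
Proof.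
rewrite {1}[r]matrix_sum_delta sum_mxtens; apply: eq_bigr => i _.
rewrite [RHS]exchange_big; apply: eq_bigr => k _.
rewrite sum_mxtens; apply: eq_bigr => j _; apply: eq_bigr => l _.
by rewrite delta_mx_tens.
Qed.

Variable n : nat.
Implicit Types (A B : 'M[R]_n) (r : 'M[R]_(n * n)).

(** The operator exchanging the two tensor factors: conjugation by it is [flip], and it is the
    Casimir element up to a scalar matrix. *)
Definition swap_mx : 'M[R]_(n * n) := \sum_i \sum_j delta_mx i j *t delta_mx j i.

Lemma mul_delta_mxE p (i j a : 'I_n) (A : 'M[R]_(n, p)) b :
  (delta_mx i j *m A) a b = (a == i)%:R * A j b.
Proof.
rewrite mxE (bigD1 j) //= big1 => [|k kj]; first by rewrite mxE eqxx andbT addr0.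
by rewrite mxE (negPf kj) andbF mul0r.
Qed.

Lemma mul_mx_deltaE p (i j b : 'I_n) (A : 'M[R]_(p, n)) a :
  (A *m delta_mx i j) a b = A a i * (b == j)%:R.
Proof.
rewrite mxE (bigD1 i) //= big1 => [|k kj]; first by rewrite mxE eqxx addr0.
by rewrite mxE (negPf kj) mulr0.
Qed.

Lemma swap_mx_tens A B : swap_mx *m (A *t B) = (B *t A) *m swap_mx.
Proof.
rewrite /swap_mx mulmx_suml mulmx_sumr; under eq_bigr do rewrite mulmx_suml.
under [RHS]eq_bigr do rewrite mulmx_sumr.
apply/matrixP=> u v; case: (mxtens_indexP u) => a c; case: (mxtens_indexP v) => b d.
transitivity (A c b * B a d).
  rewrite summxE (bigD1 a) //= [X in _ + X]big1 ?addr0 => [|i ia].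
    rewrite summxE (bigD1 c) //= [X in _ + X]big1 ?addr0 => [|j jc].
      by rewrite tensmx_mul tensmxE !mul_delta_mxE !eqxx !mul1r.
    by rewrite tensmx_mul tensmxE !mul_delta_mxE [c == _]eq_sym (negPf jc) mul0r mulr0.
  rewrite summxE big1 // => j _.
  by rewrite tensmx_mul tensmxE !mul_delta_mxE [a == _]eq_sym (negPf ia) !mul0r.
rewrite summxE (bigD1 d) //= [X in _ + X]big1 ?addr0 => [|i ia].
  rewrite summxE (bigD1 b) //= [X in _ + X]big1 ?addr0 => [|j jc].
    by rewrite tensmx_mul tensmxE !mul_mx_deltaE !eqxx !mulr1 mulrC.
  by rewrite tensmx_mul tensmxE !mul_mx_deltaE [b == _]eq_sym (negPf jc) mulr0 mul0r.
rewrite summxE big1 // => j _.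
by rewrite tensmx_mul tensmxE !mul_mx_deltaE [d == _]eq_sym (negPf ia) !mulr0.
Qed.

Lemma swap_mxK : swap_mx *m swap_mx = 1%:M.
Proof.
rewrite {2}/swap_mx mulmx_sumr.
transitivity (\sum_i \sum_j (delta_mx j j : 'M[R]_n) *t (delta_mx i i : 'M[R]_n)).
  apply: eq_bigr => i _; rewrite mulmx_sumr; apply: eq_bigr => j _.
  rewrite swap_mx_tens {1}/swap_mx mulmx_sumr (bigD1 i) //= [X in _ + X]big1 ?addr0 => [|k ki].
    rewrite mulmx_sumr (bigD1 j) //= [X in _ + X]big1 ?addr0 => [|l lj].
      by rewrite tensmx_mul !mul_delta_mx.
    by rewrite tensmx_mul !mul_delta_mx_cond [j == l]eq_sym (negPf lj) tensmx0.
  rewrite mulmx_sumr big1 // => l _.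
  by rewrite tensmx_mul !mul_delta_mx_cond [i == k]eq_sym (negPf ki) tens0mx.
rewrite -tensmx11 {2}mx1_sum_delta tensmx_sumr; apply: eq_bigr => i _.
by rewrite -tensmx_suml -mx1_sum_delta.
Qed.

Lemma tr_swap_mx : swap_mx^T = swap_mx.
Proof.
rewrite /swap_mx raddf_sum [RHS]exchange_big; apply: eq_bigr => i _.
rewrite raddf_sum; apply: eq_bigr => j _.
by rewrite /= trmx_tens !trmx_delta.
Qed.

Definition coprod A : 'M[R]_(n * n) := A *t 1%:M + 1%:M *t A.

Lemma coprodD A B : coprod (A + B) = coprod A + coprod B.
Proof. by rewrite /coprod tensmxDl tensmxDr addrACA. Qed.

Lemma coprodZ c A : coprod (c *: A) = c *: coprod A.
Proof. by rewrite /coprod tensmxZl tensmxZr scalerDr. Qed.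

Lemma coprod1 : coprod 1%:M = 2%:R%:M.
Proof. by rewrite /coprod tensmx11 [RHS]raddfMn. Qed.

Lemma tr_coprod A : (coprod A)^T = coprod A^T.
Proof. by rewrite /coprod raddfD /= !trmx_tens trmx1. Qed.

Lemma swap_mx_coprod A : comm_mx swap_mx (coprod A).
Proof. by rewrite /comm_mx /coprod mulmxDr !swap_mx_tens -mulmxDl addrC. Qed.

End Tensor.

Arguments swap_mx {R n}.

(** * Flip, conjugation and the Casimir element *)

Section TensorSquare.
Variables (L : fieldType) (n : nat).
Implicit Types (A B : 'M[L]_n) (r : 'M[L]_(n * n)).

(** Pure tensors of matrix units span the tensor square; this trades the fourfold sum in [tlift] for
    a closed formula. *)
Lemma tliftE (V : lmodType L) (f : 'M[L]_n -> 'M[L]_n -> V)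
    (h : {linear 'M[L]_(n * n) -> V}) :
  (forall A B, h (A *t B) = f A B) -> forall r, tlift f r = h r.
Proof.
move=> hf r; rewrite {2}(mxtens_sum_delta r) /tlift !linear_sum.
do 4![rewrite ?linear_sum; apply: eq_bigr => ? _].
by rewrite linearZ /= hf.
Qed.

Lemma flipE r : flip r = swap_mx *m r *m swap_mx.
Proof.
rewrite /flip (@tliftE _ _ (mulmxr swap_mx \o mulmx swap_mx)) // => A B /=.
by rewrite swap_mx_tens -mulmxA swap_mxK mulmx1.
Qed.

Lemma Ad2E X r : Ad2 X r = (X *t X) *m r *m (invmx X *t invmx X).
Proof.
rewrite /Ad2 (@tliftE _ _ (mulmxr (invmx X *t invmx X) \o mulmx (X *t X))) //.
by move=> A B /=; rewrite !tensmx_mul.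
Qed.

Lemma flipK : involutive (@flip L n).
Proof.
move=> r; rewrite !flipE !mulmxA swap_mxK mul1mx -mulmxA swap_mxK.
by rewrite mulmx1.
Qed.

Lemma flip_tens A B : flip (A *t B) = B *t A.
Proof. by rewrite flipE swap_mx_tens -mulmxA swap_mxK mulmx1. Qed.

Lemma flipM r r' : flip (r *m r') = flip r *m flip r'.
Proof.
rewrite !flipE !mulmxA; congr (_ *m _ *m _).
by rewrite -[RHS]mulmxA swap_mxK mulmx1.
Qed.

Lemma tr_flip r : (flip r)^T = flip r^T.
Proof. by rewrite !flipE !trmx_mul tr_swap_mx mulmxA. Qed.

Lemma flip_Ad2 X r : flip (Ad2 X r) = Ad2 X (flip r).
Proof. by rewrite !Ad2E !flipM !flip_tens. Qed.

Lemma flip_linear : linear (@flip L n).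
Proof.
by move=> c r r'; rewrite !flipE mulmxDr mulmxDl -scalemxAr -scalemxAl.
Qed.

HB.instance Definition _ := GRing.isLinear.Build L _ _ _ (@flip L n) flip_linear.

Lemma Ad2_linear X : linear (@Ad2 L n X).
Proof.
by move=> c r r'; rewrite !Ad2E mulmxDr mulmxDl -scalemxAr -scalemxAl.
Qed.

HB.instance Definition _ X := GRing.isLinear.Build L _ _ _ (@Ad2 L n X) (Ad2_linear X).

Lemma coboundaryE r A : coboundary r A = lie r (coprod A).
Proof. by []. Qed.

(** Subtracting the traces changes [swap_mx] by $-1/n-1/n+n/n^2$ times the identity. *)
Lemma casimirE : n%:R != 0 :> L -> casimir L n = swap_mx - n%:R^-1%:M.
Proof.
move=> n0.
have mxtr_delta i j : \tr (delta_mx i j : 'M[L]_n) = (i == j)%:R.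
  rewrite /mxtrace (bigD1 i) //= big1 ?addr0 => [|k ki]; rewrite mxE ?eqxx //.
  by rewrite (negPf ki).
have tracelessE (A : 'M[L]_n) : traceless A = A + (\tr A / - n%:R) *: 1%:M.
  by rewrite invrN mulrN scaleNr scale_scalar_mx mulr1.
transitivity (\sum_(i < n) \sum_(j < n) (delta_mx i j *t delta_mx j i
   + ((i == j)%:R / - n%:R) *: (delta_mx i j *t 1%:M)
   + (((i == j)%:R / - n%:R) *: (1%:M *t delta_mx j i)
   + ((i == j)%:R / n%:R ^+ 2) *: (1%:M : 'M[L]_(n * n))))).
  apply: eq_bigr => i _; apply: eq_bigr => j _.
  rewrite !tracelessE !mxtr_delta [j == i]eq_sym.
  rewrite tensmxDl !tensmxDr !tensmxZl !tensmxZr tensmx11 scalerA.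
  congr (_ + _ + (_ + _ *: _)); case: (i == j); rewrite ?mul0r // !mul1r.
  by rewrite -invfM mulrNN.
have sum1 (c : L) (F : 'I_n -> 'I_n -> 'M[L]_(n * n)) :
  \sum_i \sum_j ((i == j)%:R / c) *: F i j = c^-1 *: \sum_i F i i.
  rewrite scaler_sumr; apply: eq_bigr => i _; rewrite (bigD1 i) //= big1.
    by rewrite eqxx mul1r addr0.
  by move=> j /negPf ji; rewrite eq_sym ji mul0r scale0r.
under eq_bigr do rewrite !big_split.
rewrite !big_split /= -/swap_mx !sum1 sumr_const card_ord.
rewrite -tensmx_sumr -tensmx_suml -mx1_sum_delta tensmx11 -addrA; congr (_ + _).
rewrite -scaler_nat !scalerA -!scalerDl -scaleN1r scalemx1 scale_scalar_mx mulN1r.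
by rewrite invrN expr2 invfM mulfVK // addNr addr0.
Qed.

Lemma Ad2_casimir X :
  n%:R != 0 :> L -> X \in unitmx -> Ad2 X (casimir L n) = casimir L n.
Proof.
move=> n0 uX; rewrite Ad2E casimirE // mulmxBr mulmxBl -swap_mx_tens.
rewrite mul_mx_scalar -scalemxAl -[swap_mx *m _ *m _]mulmxA !tensmx_mul mulmxV //.
by rewrite tensmx11 mulmx1 scalemx1.
Qed.

Lemma tr_casimir : n%:R != 0 :> L -> (casimir L n)^T = casimir L n.
Proof. by move=> n0; rewrite casimirE // linearB /= tr_swap_mx tr_scalar_mx. Qed.

(** A matrix unit differs from its traceless part by a scalar matrix, whose coproduct is again
    scalar. *)
Lemma coprod_traceless_comm r : n%:R != 0 :> L ->
  (forall i j, comm_mx r (coprod (traceless (delta_mx i j)))) ->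
  forall i j, comm_mx r (coprod (delta_mx i j)).
Proof.
move=> n0 rT i j; rewrite -[delta_mx i j](subrK (\tr (delta_mx i j : 'M[L]_n) / n%:R)%:M).
rewrite coprodD; apply: comm_mxD; first exact: rT.
by rewrite -scalemx1 coprodZ coprod1 scale_scalar_mx; apply: comm_mx_scalar.
Qed.

(* [ab (x) 1 + 1 (x) ab + a (x) b + b (x) a = coprod a * coprod b], so the
   commutant of the [coprod a] commutes with [2 swap]. *)
Lemma comm_coprod_swap r :
  2%:R != 0 :> L -> (forall i j, comm_mx r (coprod (delta_mx i j))) ->
  comm_mx r swap_mx.
Proof.
move=> u2 rD.
have -> : (swap_mx : 'M[L]_(n * n)) = (2%:R : L)^-1 *: \sum_i \sum_j
    (coprod (delta_mx i j) *m coprod (delta_mx j i) - coprod (delta_mx i i)).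
  transitivity ((2%:R : L)^-1 *: (swap_mx + swap_mx : 'M[L]_(n * n))).
    by rewrite -mulr2n -scaler_nat scalerA mulVf // scale1r.
  congr (_ *: _); rewrite [X in _ + X]/swap_mx [X in _ + X]exchange_big -big_split /=.
  apply: eq_bigr => i _; rewrite -big_split /=; apply: eq_bigr => j _.
  rewrite /coprod mulmxDl !mulmxDr !tensmx_mul !mulmx1 !mul1mx !mul_delta_mx.
  by rewrite [X in X + (_ + _)]addrC addrACA addrK.
rewrite /comm_mx -scalemxAl -scalemxAr; congr (_ *: _).
apply: comm_mx_sum => i _; apply: comm_mx_sum => j _.
by apply: comm_mxB => //; apply: comm_mxM.
Qed.
(** Commuting with [swap_mx] means [flip r = r], so skewness leaves $2r=0$. *)
Lemma skew_invariant_eq0 r : 2%:R != 0 :> L -> n%:R != 0 :> L ->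
  (forall i j, comm_mx r (coprod (traceless (delta_mx i j)))) ->
  flip r = - r -> r = 0.
Proof.
move=> n2 n0 /(coprod_traceless_comm n0) rD fr.
have rP := comm_coprod_swap n2 rD.
have : r + r = 0.
  by apply/eqP; rewrite -[X in X + _]opprK -fr flipE -rP -mulmxA swap_mxK mulmx1 addNr.
by rewrite -mulr2n -scaler_nat => /eqP; rewrite scaler_eq0 (negPf n2) => /eqP.
Qed.

End TensorSquare.

(** * Compatibility with field embeddings *)

Section MapTensor.
Variables (S L : fieldType) (n : nat) (i : {rmorphism S -> L}).

Lemma map_swap_mx : map_mx i (swap_mx : 'M[S]_(n * n)) = swap_mx.
Proof.
rewrite /swap_mx raddf_sum; apply: eq_bigr => a _; rewrite raddf_sum.
by apply: eq_bigr => b _; rewrite /= map_mxT !map_delta_mx.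
Qed.

Lemma map_flip (r : 'M[S]_(n * n)) : map_mx i (flip r) = flip (map_mx i r).
Proof. by rewrite !flipE !map_mxM map_swap_mx. Qed.

Lemma map_Ad2 X (r : 'M[S]_(n * n)) :
  map_mx i (Ad2 X r) = Ad2 (map_mx i X) (map_mx i r).
Proof. by rewrite !Ad2E !map_mxM !map_mxT map_invmx. Qed.

Lemma map_coprod (A : 'M[S]_n) : map_mx i (coprod A) = coprod (map_mx i A).
Proof. by rewrite /coprod map_mxD !map_mxT map_mx1. Qed.

End MapTensor.

(** * Simple roots and the isomorphism theta *)

Section SimpleRoots.
Variables (L : fieldType) (n : nat).
Implicit Types (v : 'rV[L]_n) (a b : 'I_n.-1) (G : {set 'I_n.-1}).

(* The fundamental weights, as functionals on the span of the roots. *)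
Definition psum a v : L := \sum_(i < n | (i <= a)%N) v 0 i.

Lemma psum_linear a : linear (psum a : 'rV[L]_n -> L^o).
Proof.
move=> c u v; rewrite /psum scaler_sumr -big_split /=.
by apply: eq_bigr => i _; rewrite !mxE.
Qed.

HB.instance Definition _ a :=
  GRing.isLinear.Build L 'rV[L]_n L^o *:%R (psum a) (psum_linear a).

Lemma psum_root a (i j : 'I_n) :
  psum a (Defs.root L i j) = (i <= a)%:R - (j <= a)%:R.
Proof.
have psum_delta (k : 'I_n) : psum a (delta_mx 0 k) = (k <= a)%:R.
  rewrite /psum big_mkcond (bigD1 k) //= big1 ?addr0 => [|l lk].
    by rewrite mxE !eqxx; case: ifP.
  by rewrite mxE (negPf lk) andbF if_same.
by rewrite /Defs.root linearB /= !psum_delta.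
Qed.

Lemma psum_simple a b : psum a (simple_root L b) = (a == b)%:R.
Proof.
rewrite psum_root /= -val_eqE /=.
by case: ltngtP => //=; rewrite ?subrr ?subr0.
Qed.

Lemma psum_span G a v : v \in root_span L G -> psum a v != 0 -> a \in G.
Proof.
move=> vG; apply: contraR => aG.
have /subvP/(_ _ vG) : (root_span L G <= lker (linfun (psum a : 'rV[L]_n -> L^o)))%VS.
  apply/span_subvP => _ /imageP[b bG ->]; rewrite memv_ker lfunE /= psum_simple.
  have /negPf-> : a != b by apply: contraNneq aG => ->.
  by rewrite eqxx.
by rewrite memv_ker lfunE.
Qed.

(** The functionals [psum] are dual to the simple roots, so they read off the coordinates that enter
    [tau_lin]. *)
Lemma coord_simple G a v : v \in root_span L G ->
  coord [tuple simple_root L b | b < n.-1] a v = psum a v.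
Proof.
move=> vG; have /coord_span {2}-> : v \in <<[tuple simple_root L b | b < n.-1]>>%VS.
  move: v vG; apply/subvP/sub_span => _ /imageP[b bG ->] /=.
  by apply/mapP; exists b; rewrite ?mem_enum.
have Xb b : [tuple simple_root L b | b < n.-1]`_b = simple_root L b.
  by rewrite -tnth_nth tnth_mktuple.
rewrite linear_sum (bigD1 a) //= big1 ?addr0 => [|b ba].
  by rewrite Xb linearZ /= psum_simple eqxx /GRing.scale /= mulr1.
by rewrite Xb linearZ /= psum_simple eq_sym (negPf ba) scaler0.
Qed.

Variables (G1 : {set 'I_n.-1}) (tau : 'I_n.-1 -> 'I_n.-1).

(** The condition for $\tau^k(a)$ to be defined as an iterate of the partial map. *)
Definition chain k a := forall l, (l < k)%N -> iter l tau a \in G1.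

Lemma chain_add k l a : chain k a -> chain l (iter k tau a) -> chain (l + k) a.
Proof.
move=> ka la p pk; case: (ltnP p k) => [/ka//|kp].
by rewrite -(subnK kp) iterD; apply: la; rewrite ltn_subLR // addnC.
Qed.

Lemma chain_leq k l a : (l <= k)%N -> chain k a -> chain l a.
Proof. by move=> lk ka p pl; apply: ka; apply: leq_trans lk. Qed.

Lemma psum_tau_lin v a : {in G1 &, injective tau} ->
  v \in root_span L G1 -> a \in G1 -> psum (tau a) (tau_lin G1 tau v) = psum a v.
Proof.
move=> inj vG aG; rewrite /tau_lin linear_sum (bigD1 a) //= big1 ?addr0.
  by rewrite linearZ /= psum_simple eqxx (coord_simple _ vG) /GRing.scale /= mulr1.
move=> b /andP[bG ba]; rewrite linearZ /= psum_simple.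
by rewrite (inj_in_eq inj) // eq_sym (negPf ba) scaler0.
Qed.

(** By [psum_tau_lin] the nonzero coefficient at [a] travels along the iterates of [a]; these lie in
    [G1] as long as the vector stays in its span. *)
Lemma tau_pow_defined_chain k v a : {in G1 &, injective tau} ->
  tau_pow_defined G1 tau k v -> psum a v != 0 -> chain k a.
Proof.
move=> inj /forallP kv av.
suff H l : (l <= k)%N -> chain l a /\ psum (iter l tau a) (iter l (tau_lin G1 tau) v) != 0.
  by have [] := H k (leqnn k).
elim: l => [|l IH] lk; first by split.
have [ch al] := IH (ltnW lk).
have vl : iter l (tau_lin G1 tau) v \in root_span L G1 by apply: (kv (Ordinal lk)).
have lG := psum_span vl al; split; last by rewrite /= psum_tau_lin.
by move=> p; rewrite ltnS leq_eqVlt => /predU1P[->//|/ch].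
Qed.

Lemma tau_pow_defined_root k (i j : 'I_n) a : {in G1 &, injective tau} ->
  tau_pow_defined G1 tau k (Defs.root L i j) -> (i <= a < j)%N -> chain k a.
Proof.
move=> inj kij /andP[ia aj]; apply: (tau_pow_defined_chain inj kij).
by rewrite psum_root ia leqNgt aj subr0 oner_neq0.
Qed.

Lemma root_span_root (i j : 'I_n) a :
  Defs.root L i j \in root_span L G1 -> (i <= a < j)%N -> a \in G1.
Proof.
move=> ij /andP[ia aj]; apply: (psum_span ij).
by rewrite psum_root ia leqNgt aj subr0 oner_neq0.
Qed.

Lemma simple_root_span a : a \in G1 -> simple_root L a \in root_span L G1.
Proof. by move=> aG; apply/memv_span/imageP; exists a. Qed.

End SimpleRoots.

Arguments chain {n}.

(** Nilpotency bounds the chain at each of finitely many simple roots. The uniform bound starts the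
    inductions along [tau]. *)
Lemma chain_bound n (G1 G2 : {set 'I_n.-1}) (L : fieldType) tau :
  admissible L G1 G2 tau -> exists N, forall a, ~ chain G1 tau N a.
Proof.
case=> _ _ _ nilp.
have /fin_all_exists[f fP] a : exists k, ~ chain G1 tau k a.
  case: (boolP (a \in G1)) => aG; last by exists 1 => /(_ 0 isT); apply/negP.
  by have [k kG] := nilp a aG; exists k.+1 => /(_ k (ltnSn k)); apply/negP.
exists (\max_a f a) => a; apply: contra_not (fP a).
by apply: chain_leq; apply: leq_bigmax.
Qed.

(** * Iterates of theta on lower root vectors *)

Section Theta.
Variables (L : fieldType) (n : nat) (G1 G2 : {set 'I_n.-1}).
Variables (tau : 'I_n.-1 -> 'I_n.-1) (theta : 'M[L]_n -> 'M[L]_n).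
Hypothesis isoT : BD_iso G1 G2 tau theta.
Implicit Types (a b : 'I_n.-1) (i j p q : 'I_n).

(** Support on the [h]-th subdiagonal; for [h > 0] this is the span of the $e_{-\alpha}$ with
    $\alpha$ of height [h]. *)
Definition of_height h (A : 'M[L]_n) := forall p q, A p q != 0 -> p = (q + h)%N :> nat.

Lemma lie_of_height h k A B :
  of_height h A -> of_height k B -> of_height (h + k) (lie A B).
Proof.
have mul_h h' k' A' B' p q : of_height h' A' -> of_height k' B' ->
    p <> (q + (h' + k'))%N :> nat -> (A' *m B') p q = 0.
  move=> hA hB pq; rewrite mxE big1 // => m _; apply/eqP.
  rewrite mulf_eq0 -[_ || _]negbK negb_or; apply/negP => /andP[/hA Ap /hB Bm].
  by apply: pq; rewrite Ap Bm -addnA [(k' + _)%N]addnC.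
move=> hA hB p q; apply: contraNeq => /eqP pq.
rewrite /lie mxE [X in _ + X]mxE (mul_h h k A B) // (mul_h k h B A) ?subrr //.
by rewrite [(k + h)%N]addnC.
Qed.

Lemma iter_theta_e_neg k a : chain G1 tau k a ->
  iter k theta (e_neg L a) = e_neg L (iter k tau a).
Proof.
elim: k => // k IH ch /=; rewrite IH; last exact: chain_leq ch.
by rewrite (theta_neg isoT) // ch.
Qed.

Lemma iter_theta_lie k A B :
  (forall l, (l < k)%N -> simple_subalg G1 (iter l theta A)) ->
  (forall l, (l < k)%N -> simple_subalg G1 (iter l theta B)) ->
  iter k theta (lie A B) = lie (iter k theta A) (iter k theta B).
Proof.
elim: k => // k IH hA hB /=.
rewrite (IH (fun l lk => hA l (ltnW lk)) (fun l lk => hB l (ltnW lk))).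
by rewrite (theta_lie isoT (hA k (ltnSn k)) (hB k (ltnSn k))).
Qed.

Lemma delta_mx_lie (i m j : 'I_n) : i != j ->
  lie (delta_mx i m) (delta_mx m j) = delta_mx i j :> 'M[L]_n.
Proof.
by move=> ij; rewrite /lie mul_delta_mx mul_delta_mx_cond eq_sym (negPf ij) subr0.
Qed.

(** Induction on [j - i] through $E_{ji}=[E_{j,j-1},E_{j-1,i}]$. Membership of the earlier iterates
    in [simple_subalg] is carried along because [theta] respects brackets only there. *)
Lemma iter_theta_lower k i j : (i < j)%N ->
  (forall a, (i <= a < j)%N -> chain G1 tau k a) ->
  (forall l, (l < k)%N -> simple_subalg G1 (iter l theta (delta_mx j i))) /\
  of_height (j - i) (iter k theta (delta_mx j i)).
Proof.
move=> ij; have [h] := ubnP (j - i); elim: h => // h IH in i j ij *.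
rewrite ltnS => jih ch.
have j0 : (j.-1 < n.-1)%N by have := ltn_ord j; lia.
pose b : 'I_n.-1 := Ordinal j0.
have bj : shi b = j by apply: val_inj => /=; lia.
have neg l : (l <= k)%N -> iter l theta (e_neg L b) = e_neg L (iter l tau b).
  move=> lk; apply/iter_theta_e_neg/chain_leq/ch; first exact: lk.
  by rewrite /=; lia.
have chb : chain G1 tau k b.
  by apply: ch => /=; lia.
have height_neg a : of_height 1 (e_neg L a).
  move=> p q; rewrite mxE.
  case: (boolP ((p == shi a) && _)) => [/andP[/eqP-> /eqP->] _|_]; last by rewrite eqxx.
  by rewrite /= addn1.
have neg_in l : (l < k)%N -> simple_subalg G1 (iter l theta (e_neg L b)).
  move=> lk; rewrite neg 1?ltnW //; apply: lie_gen_in.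
  by exists (iter l tau b); [apply: chb | right].
have [ib|bi] := ltnP i (slo b); last first.
  have {bi}ib : slo b = i.
    by apply: val_inj; move: bi => /=; lia.
  have -> : delta_mx j i = e_neg L b by rewrite /e_neg bj ib.
  have -> : (j - i = 1)%N by rewrite -bj -ib /= subSnn.
  by split=> //; rewrite neg.
have [||inB hB] := IH i (slo b) ib.
- by move: ib => /=; lia.
- by move=> a /andP[ia ab]; apply: ch; move: ab => /=; lia.
have ->: delta_mx j i = lie (e_neg L b) (delta_mx (slo b) i).
  by rewrite /e_neg bj delta_mx_lie // -val_eqE neq_ltn ij orbT.
split=> [l lk|].
  rewrite iter_theta_lie => [|l' ll|l' ll].
  - by apply: lie_gen_lie; [apply: neg_in | apply: inB].
  - by apply: neg_in; apply: ltn_trans lk.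
  - by apply: inB; apply: ltn_trans lk.
rewrite iter_theta_lie //.
have -> : (j - i = 1 + (slo b - i))%N by move: ib => /=; lia.
by apply: lie_of_height => //; rewrite neg.
Qed.
End Theta.

Section Slices.
Variables (L : fieldType) (n : nat).
Implicit Types (A B : 'M[L]_n) (r : 'M[L]_(n * n)).

(* The left leg of [r] paired with the [(k, l)] entry of the right leg. *)
Definition slice (k l : 'I_n) r : 'M[L]_n :=
  \matrix_(p, q) r (mxtens_index (p, k)) (mxtens_index (q, l)).

Lemma slice_linear k l : linear (slice k l).
Proof. by move=> c r r'; apply/matrixP => p q; rewrite !mxE. Qed.

HB.instance Definition _ k l :=
  GRing.isLinear.Build L _ _ _ (slice k l) (slice_linear k l).

Lemma slice_tens k l A B : slice k l (A *t B) = B k l *: A.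
Proof. by apply/matrixP => p q; rewrite !mxE !mxtens_indexK mulrC. Qed.

Lemma slice_mul k l C D r :
  slice k l ((C *t 1%:M) *m r *m (D *t 1%:M)) = C *m slice k l r *m D.
Proof.
rewrite [r]mxtens_sum_delta.
do 4![rewrite ?(mulmx_sumr, mulmx_suml, linear_sum) /= ?(mulmx_sumr, mulmx_suml);
      apply: eq_bigr => ? _].
rewrite -scalemxAr -scalemxAl !linearZ /= !tensmx_mul mul1mx mulmx1.
by rewrite !slice_tens -scalemxAl -scalemxAr -scalemxAl.
Qed.

End Slices.

(** * The legs of a Belavin-Drinfeld r-matrix *)

Section BDLegs.
Variables (L : fieldType) (n : nat) (G1 G2 : {set 'I_n.-1}).
Variables (tau : 'I_n.-1 -> 'I_n.-1) (theta : 'M[L]_n -> 'M[L]_n).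
Hypothesis isoT : BD_iso G1 G2 tau theta.
Hypothesis adm : admissible L G1 G2 tau.
Implicit Types (a b : 'I_n.-1) (i j p q : 'I_n).

Lemma BD_term_height k i j : (i < j)%N ->
  tau_pow_defined G1 tau k (Defs.root L i j) ->
  of_height (j - i) (iter k theta (delta_mx j i)).
Proof.
move=> ij kij; apply: (proj2 (iter_theta_lower isoT ij _)) => a.
exact: (tau_pow_defined_root (adm_inj adm) kij).
Qed.

Lemma BD_term_upper k i j p q : (i < j)%N -> (p <= q)%N ->
  tau_pow_defined G1 tau k (Defs.root L i j) ->
  iter k theta (delta_mx j i) p q = 0.
Proof.
move=> ij pq kij; apply/eqP/negPn/negP => /(BD_term_height ij kij).
lia.
Qed.

Lemma slice_cartan r p q : in_tensor (@cartan L n) r -> p != q -> slice p q r = 0.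
Proof.
case=> m [u [v [_ Cv ->]]] pq; rewrite linear_sum big1 // => x _ /=.
have [/is_diag_mxP dv _] := Cv x.
by rewrite slice_tens dv // scale0r.
Qed.

(* With [t] outside [G1] the right legs of a Belavin--Drinfeld r-matrix
   preserve the span of the last [n - t - 1] basis vectors. *)
Lemma BD_right_leg r0 (t : 'I_n.-1) : in_tensor (@cartan L n) r0 -> t \notin G1 ->
  ((1%:M : 'M_n) *t (pid_mx t.+1 : 'M_n)) *m (r0 + BD_r1 G1 tau theta) *m
    ((1%:M : 'M_n) *t (copid_mx t.+1 : 'M_n)) = 0.
Proof.
move=> r0C tG1.
pose h : {linear 'M[L]_(n * n) -> 'M[L]_(n * n)} := mulmxr ((1%:M : 'M[L]_n) *t (copid_mx t.+1 : 'M[L]_n)) \o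
  mulmx ((1%:M : 'M[L]_n) *t (pid_mx t.+1 : 'M[L]_n)).
(* [h] cuts the right leg down to the block with rows up to [t] and columns beyond [t]. *)
have h0 (A B : 'M[L]_n) :
    (forall p q, (p <= t < q)%N -> B p q = 0) -> h (A *t B) = 0.
  move=> B0; rewrite /h /= !tensmx_mul mul1mx mulmx1.
  have -> : (pid_mx t.+1 : 'M_n) *m B *m copid_mx t.+1 = 0; last by rewrite tensmx0.
  have pidE : (pid_mx t.+1 : 'M_n) *m B = \matrix_(p, q) ((p < t.+1)%:R * B p q).
    apply/matrixP => p q; rewrite !mxE (bigD1 p) //= big1 ?addr0.
      by rewrite mxE eqxx.
    by move=> x xp; rewrite mxE eq_sym val_eqE (negPf xp) mul0r.
  rewrite pidE; apply/matrixP => p q.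
  rewrite !mxE (bigD1 q) //= big1 ?addr0 => [|x xq].
    rewrite !mxE eqxx ltnS; case: (leqP p t) => pt; last by rewrite /= !mul0r.
    case: (ltnP q t.+1) => qt; first by rewrite /= eqxx subrr mulr0.
    by rewrite B0 ?pt // mulr0 mul0r.
  by rewrite !mxE (negPf xq) val_eqE (negPf xq) /= subrr mulr0.
rewrite -[LHS]/(h _) linearD.
have [m [u [v [_ Cv ->]]]] := r0C.
rewrite [X in X + _]linear_sum [X in X + _]big1 => [|x _]; last first.
  apply: h0 => p q /andP[pt tq]; have [/is_diag_mxP dv _] := Cv x; apply: dv.
  by lia.
rewrite add0r /BD_r1 linearD [X in X + _]linear_sum [X in X + _]big1 => [|i _]; last first.
  rewrite linear_sum big1 // => j ij; apply: h0 => p q /andP[pt tq].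
  rewrite mxE; case: eqVneq => // pj; case: eqVneq => // qi; subst p q.
  by move: ij pt tq; lia.
rewrite add0r linear_sum big1 // => i _; rewrite linear_sum big1 // => j /andP[ij ijG].
rewrite linear_sum big1 // => k kij; rewrite /wedge linearB.
rewrite !h0 ?subrr // => p q /andP[pt tq].
  rewrite mxE; case: eqVneq => // pj; case: eqVneq => // qi; subst p q.
  (* A root in the span of [G1] whose matrix unit meets this block involves the simple root [t]. *)
  by case/negP: tG1; apply: (root_span_root ijG); rewrite pt.
by apply: BD_term_upper => //; lia.
Qed.

(** The second half of each wedge has a strictly upper triangular right leg and is not seen at this
    entry. *)
Lemma slice_r1_lower b :
  slice (shi b) (slo b) (BD_r1 G1 tau theta) = e_pos L b +
  \sum_(i < n) \sum_(j < n | (i < j)%N && (Defs.root L i j \in root_span L G1))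
      \sum_(1 <= k < n | tau_pow_defined G1 tau k (Defs.root L i j))
        iter k theta (delta_mx j i) (shi b) (slo b) *: delta_mx i j.
Proof.
rewrite /BD_r1 linearD /=; congr (_ + _).
  rewrite linear_sum (bigD1 (slo b)) //= [X in _ + X]big1 ?addr0 => [|i ib].
    rewrite linear_sum (bigD1 (shi b)) /= ?ltnSn // [X in _ + X]big1 ?addr0 => [|j /andP[_ jb]].
      by rewrite /= slice_tens mxE !eqxx scale1r.
    by rewrite /= slice_tens mxE eq_sym (negPf jb) scale0r.
  rewrite linear_sum big1 // => j _.
  by rewrite /= slice_tens mxE [slo b == _]eq_sym (negPf ib) andbF scale0r.
rewrite linear_sum; apply: eq_bigr => i _.
rewrite linear_sum; apply: eq_bigr => j /andP[ij _].
rewrite linear_sum; apply: eq_bigr => k kij.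
rewrite /wedge linearB /= !slice_tens mxE.
case: eqVneq => [bi|]; last by rewrite scale0r subr0.
case: eqVneq => [bj|]; last by rewrite scale0r subr0.
by move: ij; rewrite -bi -bj /=; lia.
Qed.

(** Right legs $\theta^k(e_{-\alpha})$ are strictly lower triangular, so only the second halves of
    the wedges with $\alpha=a$ are seen here. *)
Lemma slice_r1_upper a : a \in G1 ->
  slice (slo a) (shi a) (BD_r1 G1 tau theta) =
  - \sum_(1 <= k < n | tau_pow_defined G1 tau k (simple_root L a))
        e_neg L (iter k tau a).
Proof.
move=> aG; rewrite /BD_r1 linearD /= [X in X + _]linear_sum [X in X + _]big1.
  rewrite add0r linear_sum (bigD1 (slo a)) //= [X in _ + X]big1 ?addr0 => [|i ia].
    rewrite linear_sum (bigD1 (shi a)) /=; last by rewrite ltnSn simple_root_span.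
    rewrite [X in _ + X]big1 ?addr0 => [|j /andP[/andP[ij _] ja]].
      rewrite linear_sum -sumrN; apply: eq_bigr => k kij.
      rewrite /wedge linearB /= !slice_tens mxE !eqxx scale1r.
      rewrite BD_term_upper //= scale0r sub0r.
      congr (- _); apply: (iter_theta_e_neg isoT).
      by apply: (tau_pow_defined_root (adm_inj adm) kij); rewrite /= leqnn ltnSn.
    rewrite linear_sum big1 // => k kij.
    rewrite /wedge linearB /= !slice_tens BD_term_upper //=.
    by rewrite mxE [shi a == _]eq_sym (negPf ja) andbF !scale0r subrr.
  rewrite linear_sum big1 // => j /andP[ij _]; rewrite linear_sum big1 // => k kij.
  rewrite /wedge linearB /= !slice_tens BD_term_upper //=.
  by rewrite mxE [slo a == _]eq_sym (negPf ia) !scale0r subrr.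
move=> i _; rewrite linear_sum big1 // => j ij.
rewrite /= slice_tens mxE; case: eqVneq => [ai|]; last by rewrite scale0r.
case: eqVneq => [aj|]; last by rewrite scale0r.
by move: ij; rewrite -ai -aj /=; lia.
Qed.

Variables (C D : 'M[L]_n) (r0 : 'M[L]_(n * n)).
Hypothesis r0C : in_tensor (@cartan L n) r0.
Hypothesis CrD : (C *t 1%:M) *m (r0 + BD_r1 G1 tau theta) *m (D *t 1%:M) = 0.

(** In the application [C] gives equations of the column span of [D], and [CrD] says that the left
    legs preserve it. Off-diagonal slices do not see [r0]. *)
Lemma slice_r1_eq0 p q : p != q -> C *m slice p q (BD_r1 G1 tau theta) *m D = 0.
Proof.
move=> pq; have := slice_mul p q C D (r0 + BD_r1 G1 tau theta).
by rewrite CrD linear0 linearD /= (slice_cartan r0C pq) add0r => <-.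
Qed.

Lemma slo_neq_shi a : slo a != shi a :> 'I_n.
Proof. by rewrite -val_eqE /= neq_ltn ltnSn. Qed.

(** Descending induction on chain length: the slice is [e_pos c] plus multiples of [e_pos a] with
    $\tau^k(a)=c$, $k\ge1$, and the chain from such an [a] is longer. *)
Lemma e_pos_eq0 b : C *m e_pos L b *m D = 0.
Proof.
pose x a := C *m e_pos L a *m D.
have step c : (forall a k, chain G1 tau k a -> (0 < k)%N -> iter k tau a = c -> x a = 0) ->
    x c = 0.
  move=> hx; have := @slice_r1_eq0 (shi c) (slo c).
  rewrite eq_sym slo_neq_shi => /(_ isT).
  rewrite slice_r1_lower mulmxDr mulmxDl mulmx_sumr mulmx_suml big1 ?addr0 // => i _.
  rewrite mulmx_sumr mulmx_suml big1 // => j /andP[ij _].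
  rewrite mulmx_sumr mulmx_suml big_nat_cond big1 // => k /andP[/andP[k0 _] kij].
  rewrite -scalemxAr -scalemxAl.
  have [->|nz] := eqVneq (iter k theta (delta_mx j i) (shi c) (slo c)) 0.
    by rewrite scale0r.
  (* A nonzero entry on the first subdiagonal forces height one, so the root is simple. *)
  have ji := BD_term_height ij kij nz.
  have a0 : (i < n.-1)%N by have := ltn_ord j; lia.
  pose a : 'I_n.-1 := Ordinal a0.
  have ai : i = slo a by apply: val_inj.
  have aj : j = shi a by apply: val_inj; move: ji => /=; lia.
  have cha : chain G1 tau k a.
    by apply: (tau_pow_defined_root (adm_inj adm) kij); rewrite /= leqnn ij.
  rewrite ai aj -/(e_pos L a) -/(x a) (hx a k) ?scaler0 //.
  move: nz; rewrite ai aj -/(e_neg L a) (iter_theta_e_neg isoT) // mxE.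
  case: (boolP (_ && _)) => [/andP[/eqP e _] _|_]; last by rewrite eqxx.
  by apply: val_inj; case: (congr1 val e) => /= ->.
have [N chN] := chain_bound adm.
suff H m : forall c, chain G1 tau (N - m) c -> x c = 0.
  by apply: (H N); rewrite subnn.
elim: m => [|m IH] c chc; first by case: (chN c); rewrite -[N]subn0.
apply: step => a k ka k0 e; apply: IH; rewrite -e in chc.
by apply: chain_leq (chain_add ka chc); lia.
Qed.

(** The slice is $-\sum_{k\ge1}e_{-\tau^k(c)}$; induction on a bound for the chain removes the terms
    with $k\ge2$ and leaves $e_{-\tau(c)}$. *)
Lemma e_neg_eq0 a : a \in G1 -> C *m e_neg L (tau a) *m D = 0.
Proof.
have [N chN] := chain_bound adm.
suff H m : forall c, c \in G1 -> ~ chain G1 tau m c -> C *m e_neg L (tau c) *m D = 0.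
  by move=> aG; apply: (H N).
elim: m => [|m IH] c cG chc; first by case: chc.
have := slice_r1_eq0 (slo_neq_shi c).
rewrite slice_r1_upper // mulmxN mulNmx => /eqP; rewrite oppr_eq0 => /eqP.
have n1 : (1 < n)%N by have := ltn_ord c; lia.
have t1 : tau_pow_defined G1 tau 1 (simple_root L c).
  by apply/forallP => -[[|//] ?]; apply: simple_root_span.
rewrite big_ltn_cond // t1 mulmxDr mulmxDl mulmx_sumr mulmx_suml big_nat_cond big1 ?addr0 //.
move=> k /andP[/andP[k0 _] kc].
have chk : chain G1 tau k c.
  by apply: (tau_pow_defined_root (adm_inj adm) kc); rewrite /= leqnn ltnSn.
have -> : iter k tau c = tau (iter k.-1 tau c) by rewrite -iterS prednK // ltnW.
apply: IH; first by apply: chk; lia.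
move=> chm; apply: chc; apply: (chain_leq _ (chain_add (chain_leq (leq_pred k) chk) chm)).
lia.
Qed.

End BDLegs.

(** * Subspaces preserved by simple root vectors *)

Lemma mxrank_zero_cols (L : fieldType) n m (C : 'M[L]_n) : (m <= n)%N ->
  (forall p q : 'I_n, (q < m)%N -> C p q = 0) -> (\rank C <= n - m)%N.
Proof.
move=> mn C0; rewrite -(rank_copid_mx L mn); apply: (@leq_trans (\rank (C *m copid_mx m))); last first.
  exact: mxrankM_maxr.
suff -> : C *m copid_mx m = C by [].
apply/matrixP => p q; rewrite !mxE (bigD1 q) //= big1 ?addr0 => [|x xq].
  rewrite !mxE !eqxx /=; case: ltnP => qm; last by rewrite subr0 mulr1.
  by rewrite C0 // mul0r.
by rewrite !mxE (negPf xq) val_eqE (negPf xq) /= subrr mulr0.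
Qed.

Lemma mxrank_zero_rows (L : fieldType) n m (D : 'M[L]_n) : (m <= n)%N ->
  (forall p q : 'I_n, (m <= p)%N -> D p q = 0) -> (\rank D <= m)%N.
Proof.
move=> mn D0; rewrite -[X in (_ <= X)%N](@rank_pid_mx L n n m mn mn).
apply: (@leq_trans (\rank ((pid_mx m : 'M_n) *m D))); last exact: mxrankM_maxl.
suff -> : (pid_mx m : 'M_n) *m D = D by [].
apply/matrixP => p q; rewrite !mxE (bigD1 p) //= big1 ?addr0 => [|x xp].
  rewrite !mxE !eqxx /=; case: ltnP => pm; first by rewrite mul1r.
  by rewrite D0 // mulr0.
by rewrite mxE eq_sym val_eqE (negPf xp) mul0r.
Qed.

(* [D] spans a subspace [U] of dimension [t + 1] with equations [C].  If all
   [E_{b,b+1}] preserve [U] then [U] is spanned by the first basis vectors, so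
   that [E_{t+1,t}] does not preserve it. *)
Lemma upper_invariant_subspace (L : fieldType) n (G : 'M[L]_n) (t : 'I_n.-1)
    (C := copid_mx t.+1 *m G) (D := invmx G *m (pid_mx t.+1 : 'M_n)) :
  G \in unitmx -> (forall b, C *m e_pos L b *m D = 0) ->
  C *m e_neg L t *m D = 0 -> False.
Proof.
move=> uG Cpos Cneg.
have tn : (t.+1 < n)%N by have := ltn_ord t; lia.
have CD : C *m D = 0.
  by rewrite /C /D mulmxA mulmxK // mul_copid_mx_pid // ltnW.
have rC : \rank C = (n - t.+1)%N.
  by rewrite mxrankMfree ?row_free_unit // rank_copid_mx // ltnW.
have rD : \rank D = t.+1.
  by rewrite eqmxMfull ?row_full_unit ?unitmx_inv // rank_pid_mx // ltnW.
(* [C *m A *m D = 0] says that [A] preserves the subspace; inserting [GZ] between the factors shows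
   closure under products. *)
have CM A B : C *m A *m D = 0 -> C *m B *m D = 0 -> C *m (A *m B) *m D = 0.
  have GZ : D *m G + invmx G *m C = 1%:M.
    by rewrite /D /C -mulmxA -mulmxDr -mulmxDl addrC subrK mul1mx mulVmx.
  have -> : C *m (A *m B) *m D = C *m A *m D *m (G *m B *m D) +
      C *m A *m invmx G *m (C *m B *m D).
    by rewrite -[in LHS](mulmx1 A) -GZ mulmxDr mulmxDl mulmxDr mulmxDl !mulmxA.
  by move=> -> ->; rewrite mul0mx mulmx0 addr0.
clearbody C D.
have Cdelta (p q : 'I_n) : (p < q)%N -> C *m delta_mx p q *m D = 0.
  have [h] := ubnP (q - p); elim: h => // h IH in q *; rewrite ltnS => qph pq.
  have q0 : (q.-1 < n.-1)%N by have := ltn_ord q; lia.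
  pose b : 'I_n.-1 := Ordinal q0.
  have bq : shi b = q by apply: val_inj => /=; lia.
  have [pb|bp] := ltnP p (slo b).
    rewrite -bq -(mul_delta_mx (slo b)); apply: CM (Cpos b).
    by apply: IH => //; move: pb => /=; lia.
  have <- : slo b = p by apply: val_inj; move: bp => /=; lia.
  by rewrite -bq; apply: Cpos.
have col_row (p q : 'I_n) i j : C *m delta_mx p q *m D = 0 -> C i p * D q j = 0.
  move=> e; have -> : C i p * D q j = (C *m delta_mx p q *m D) i j.
    rewrite mxE (bigD1 q) //= big1 ?addr0 => [|x xq].
      by rewrite mul_mx_deltaE eqxx mulr1.
    by rewrite mul_mx_deltaE (negPf xq) mulr0 mul0r.
  by rewrite e mxE.
have [q0 Dq0] : exists q : 'I_n, row q D != 0.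
  apply/existsP; rewrite -negb_forall; apply/negP => /forallP D0.
  suff D00 : D = 0 by move: rD; rewrite D00 mxrank0.
  by apply/row_matrixP => q; rewrite row0; apply/eqP.
(* The last nonzero row of [D]: the subspace lies in the span of the basis vectors up to [r]. *)
pose r := [arg max_(q > q0 | row q D != 0) (q : nat)].
have [Dr rmax] : row r D != 0 /\ forall q : 'I_n, row q D != 0 -> (q <= r)%N.
  by rewrite /r; case: arg_maxnP.
have Crow (p : 'I_n) i q : row q D != 0 -> C *m delta_mx p q *m D = 0 -> C i p = 0.
  case/rV0Pn=> j; rewrite mxE => Dqj /(col_row _ _ i j)/eqP.
  by rewrite mulf_eq0 (negPf Dqj) orbF => /eqP.
have Clt (p i : 'I_n) : (p < r)%N -> C i p = 0.
  by move=> pr; apply: (Crow _ _ r) => //; apply: Cdelta.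
have D0 (p q : 'I_n) : (r.+1 <= p)%N -> D p q = 0.
  move=> rp; have: row p D == 0.
    by apply/negPn/negP => /rmax; rewrite leqNgt rp.
  by move=> /eqP/rowP/(_ q); rewrite !mxE.
(* In [C *m D = 0] only index [r] contributes to row [r] of [D]: earlier columns of [C] and later
   rows of [D] vanish. *)
have Cr i : C i r = 0.
  apply: (Crow _ _ r) => //; apply/matrixP => k j.
  have := congr1 (fun M : 'M[L]_n => M k j) CD.
  rewrite !mxE (bigD1 r) //= [X in _ + X]big1 ?addr0 => [CDr|x xr].
    rewrite (bigD1 r) //= [X in _ + X]big1 ?addr0 => [|x xr].
      by rewrite mul_mx_deltaE eqxx mulr1.
    by rewrite mul_mx_deltaE (negPf xr) mulr0 mul0r.
  have [xlt|xgt|/val_inj e] := ltngtP x r; first by rewrite Clt // mul0r.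
    by rewrite D0 // mulr0.
  by rewrite e eqxx in xr.
(* The ranks of [D] and [C] bound [r] from below and above by [t]. *)
have tr : (t <= r)%N by rewrite -ltnS -rD mxrank_zero_rows.
have rt : r = slo t.
  apply: val_inj; apply/eqP; rewrite eqn_leq tr andbT /= leqNgt; apply/negP => ltr.
  have : (\rank C <= n - r.+1)%N.
    apply: mxrank_zero_cols => // p q; rewrite ltnS leq_eqVlt => /predU1P[/val_inj->|/Clt//].
    exact: Cr.
  by rewrite rC; have := ltn_ord r; lia.
(* Since row [t] of [D] is nonzero, [Cneg] also kills column [t + 1] of [C], which makes its rank
   too small. *)
have : (\rank C <= n - t.+2)%N.
  apply: mxrank_zero_cols => // p q.
  rewrite ltnS leq_eqVlt => /predU1P[qt|].
    have -> : q = shi t by apply: val_inj.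
    by apply: (Crow _ _ (slo t)) => //; rewrite -rt.
  rewrite ltnS leq_eqVlt => /predU1P[qt|qt].
    have -> : q = r by rewrite rt; apply: val_inj.
    exact: Cr.
  by apply: Clt; rewrite rt.
by rewrite rC; lia.
Qed.

(** * Symmetric part and conjugation *)

Section Symmetry.
Variables (L : fieldType) (n : nat).
Hypothesis n0 : n%:R != 0 :> L.

Lemma diag_part_linear m : linear (@diag_part L m).
Proof.
by move=> c A B; apply/matrixP => i j; rewrite !mxE mulrnDl mulrnAr.
Qed.

HB.instance Definition _ m :=
  GRing.isLinear.Build L _ _ _ (@diag_part L m) (@diag_part_linear m).

Lemma diag_part_tens (A B : 'M[L]_n) :
  diag_part (A *t B) = diag_part A *t diag_part B.
Proof.
apply/matrixP => u v; case: (mxtens_indexP u) => i k; case: (mxtens_indexP v) => j l.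
rewrite tensmxE mxE tensmxE !mxE (can_eq (@mxtens_indexK n n)) xpair_eqE.
by rewrite mulrnAl mulrnAr -mulrnA mulnb andbC.
Qed.

Lemma casimir0E : casimir0 L n = \sum_i delta_mx i i *t delta_mx i i - n%:R^-1%:M.
Proof.
rewrite /casimir0 (@tliftE _ _ _ _ (@diag_part L (n * n))); last exact: diag_part_tens.
rewrite casimirE // linearB /=; congr (_ - _); last first.
  by apply/matrixP => i j; rewrite !mxE; case: eqVneq.
rewrite /swap_mx linear_sum; apply: eq_bigr => i _.
have diag_delta (p q : 'I_n) : diag_part (delta_mx p q : 'M[L]_n) = delta_mx p q *+ (p == q).
  apply/matrixP => x y; rewrite mxE mulmxnE mxE -!mulrnA; congr (_ *+ _).
  by case: (x =P p) => [->|]; case: (y =P q) => [->|].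
rewrite linear_sum (bigD1 i) //= [X in _ + X]big1 ?addr0 => [|j ji].
  by rewrite diag_part_tens diag_delta eqxx.
by rewrite diag_part_tens !diag_delta (negPf ji) mulr0n tensmx0.
Qed.

Lemma flip_wedge (A B : 'M[L]_n) : flip (wedge A B) = - wedge A B.
Proof. by rewrite /wedge linearB /= !flip_tens opprB. Qed.

Variables (G1 G2 : {set 'I_n.-1}) (tau : 'I_n.-1 -> 'I_n.-1).

(** The wedges are skew, [r0] contributes $\Omega_0$, and the standard part with its flip gives the
    off-diagonal terms of [swap_mx]. *)
Lemma BD_symmetric_part r : BD_rmatrix G1 G2 tau r -> r + flip r = casimir L n.
Proof.
case=> _ [r0 [theta [[_ r0s _] _ ->]]].
rewrite linearD /= addrACA r0s casimirE // casimir0E addrAC; congr (_ - _).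
rewrite /BD_r1 linearD /= addrACA.
set w := (X in _ + (_ + (X + _))).
have -> : flip w = - w.
  rewrite /w linear_sum -sumrN; apply: eq_bigr => i _.
  rewrite linear_sum -sumrN; apply: eq_bigr => j _.
  rewrite linear_sum -sumrN; apply: eq_bigr => k _; exact: flip_wedge.
rewrite subrr addr0 linear_sum /=.
under [X in _ + (_ + X)]eq_bigr do rewrite linear_sum.
rewrite [X in _ + (_ + X)](exchange_big_dep predT) //= -!big_split /=.
apply: eq_bigr => i _; rewrite [RHS](bigD1 i) //=; congr (_ + _).
rewrite [RHS](bigID (fun j : 'I_n => (i < j)%N)) /=; congr (_ + _).
  by apply: eq_bigl => j; rewrite -val_eqE neq_ltn; case: (ltngtP i j); rewrite ?andbF.
rewrite (eq_bigl (fun j : 'I_n => (j != i) && ~~ (i < j)%N)); last first.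
  by move=> j; rewrite -val_eqE neq_ltn; case: (ltngtP i j); rewrite ?andbF.
by apply: eq_bigr => j _; rewrite flip_tens.
Qed.
End Symmetry.

(* [i] and [j] play the roles of the identity and of a Galois automorphism which
   is nontrivial on [K]: the real form consists of the [u] with [anti u]. *)
Section ConjugateCobracket.
Variables (S L : fieldType) (i j : {rmorphism S -> L}) (n : nat).
Implicit Types (u : 'M[S]_n) (r : 'M[S]_(n * n)).

Definition anti u := map_mx j u = - (map_mx i u)^T.

(** On a tensor of two [anti] matrices the signs cancel, so [j] acts on the cobracket as
    transposition. Transposing a commutator reverses it, and this sign is absorbed by [anti u]. *)
Lemma comm_conjugate_defect r u : anti u ->
  in_tensor (fun A => exists2 v, anti v & A = map_mx i v)
    (coboundary (map_mx i r) (map_mx i u)) ->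
  comm_mx (map_mx j r - (map_mx i r)^T) (coprod (map_mx j u)).
Proof.
move=> au [m [a [b [Va Vb]]]].
have map_cob (f : {rmorphism S -> L}) :
    coboundary (map_mx f r) (map_mx f u) = map_mx f (coboundary r u).
  by rewrite !coboundaryE /lie map_mxB !map_mxM map_coprod.
rewrite map_cob => e.
have /fin_all_exists2[a' aa ae] := Va; have /fin_all_exists2[b' ab be] := Vb.
have {}e : coboundary r u = \sum_x a' x *t b' x.
  apply: (@map_mx_inj _ _ i); rewrite e raddf_sum; apply: eq_bigr => x _.
  by rewrite /= map_mxT -ae -be.
have : coboundary (map_mx j r) (map_mx j u) =
    (coboundary (map_mx i r) (map_mx i u))^T.
  rewrite !map_cob e !raddf_sum /=; apply: eq_bigr => x _.
  rewrite !map_mxT aa ab trmx_tens -!scaleN1r tensmxZl tensmxZr scalerA.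
  by rewrite mulrNN mulr1 scale1r.
rewrite !coboundaryE /lie linearB /= !trmx_mul tr_coprod.
have -> : (map_mx i u)^T = - map_mx j u by rewrite au opprK.
rewrite -[- map_mx j u]scaleN1r coprodZ scaleN1r mulmxN mulNmx opprK addrC.
rewrite addrC [RHS]addrC => /eqP; rewrite subr_eq => /eqP e'.
rewrite /comm_mx mulmxBl mulmxBr e' addrAC [_ - _ - _]addrAC subrr add0r.
by rewrite addrC.
Qed.

Hypotheses (n0 : n%:R != 0 :> L) (two0 : 2%:R != 0 :> L).

(* The defect commutes with [sl], so its skew part is an invariant of
   [Lambda^2 sl] and vanishes; the symmetric parts are multiples of the Casimir. *)
Lemma conjugate_rmatrix (c : S) r :
  j c = - i c -> map_mx i r + flip (map_mx i r) = i c *: casimir L n ->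
  (forall p q, comm_mx (map_mx j r - (map_mx i r)^T)
                 (coprod (traceless (delta_mx p q)))) ->
  map_mx j r = - (flip (map_mx i r))^T.
Proof.
move=> jc sym; pose N : 'M[L]_(n * n) := map_mx j r - (map_mx i r)^T.
rewrite -/N => cN.
have symj : map_mx j r + flip (map_mx j r) = - (i c *: casimir L n).
  have symS : r + flip r = c *: (swap_mx - n%:R^-1%:M).
    apply: (@map_mx_inj _ _ i); rewrite map_mxD map_flip sym casimirE // map_mxZ.
    by rewrite map_mxB map_swap_mx map_scalar_mx fmorphV rmorph_nat.
  rewrite -map_flip -map_mxD symS map_mxZ map_mxB map_swap_mx map_scalar_mx.
  by rewrite fmorphV rmorph_nat casimirE // jc scaleNr.
have : N - flip N = 0.
  apply: (skew_invariant_eq0 two0 n0).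
    move=> p q; have cs := comm_mx_sym (swap_mx_coprod (traceless (delta_mx p q : 'M[L]_n))).
    have cN' := comm_mx_sym (cN p q).
    apply: comm_mx_sym; apply: comm_mxB => //.
    by rewrite flipE; apply: comm_mxM => //; apply: comm_mxM.
  by rewrite linearB /= flipK [RHS]opprB.
rewrite /N linearB /= -tr_flip => /eqP; rewrite subr_eq0 => /eqP e.
have symT : (map_mx i r)^T + (flip (map_mx i r))^T = i c *: casimir L n.
  by rewrite -linearD sym linearZ /= tr_casimir.
apply/eqP; rewrite -addr_eq0; apply/eqP.
move: (map_mx j r) (flip _) (map_mx i r)^T (flip _)^T symj symT e => x x' y y' xx yy e.
have e' : x + y' = x' + y by move/eqP: e; rewrite subr_eq => /eqP->; rewrite addrAC subrK.
(* Adding the two forms of [x + y'] cancels the Casimir multiples, which have opposite signs because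
   [j] negates [c]. *)
have /eqP : 2%:R *: (x + y') = 0.
  by rewrite scaler_nat mulr2n {2}e' addrACA xx [y' + y]addrC yy addNr.
by rewrite scaler_eq0 (negPf two0) => /eqP.
Qed.
End ConjugateCobracket.

(** * The special unitary real form *)

Lemma mul_tens_tens (L : fieldType) n (A A' U U' V V' B B' : 'M[L]_n) r :
  (A *t A') *m ((U *t U') *m r *m (V *t V')) *m (B *t B') =
  ((A *m U) *t (A' *m U')) *m r *m ((V *m B) *t (V' *m B')).
Proof. by rewrite -!tensmx_mul !mulmxA. Qed.

(* A subspace preserved by the right legs of [r] and defined over [S] is moved
   by [j] to one whose annihilator is preserved by the left legs. *)
Lemma transported_leg (S L : fieldType) (i j : {rmorphism S -> L}) n m
    (X : 'M[S]_n) (r : 'M[S]_(n * n)) (G := (map_mx j X)^T *m map_mx i X) :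
  map_mx i X \in unitmx ->
  Ad2 (map_mx j X) (map_mx j r) = (flip (Ad2 (map_mx i X) (map_mx i r)))^T ->
  ((1%:M : 'M_n) *t (pid_mx m : 'M_n)) *m map_mx i r *m
    ((1%:M : 'M_n) *t (copid_mx m : 'M_n)) = 0 ->
  ((copid_mx m *m G) *t (1%:M : 'M_n)) *m map_mx i r *m
    ((invmx G *m (pid_mx m : 'M_n)) *t (1%:M : 'M_n)) = 0.
Proof.
move=> uX rj leg.
set ri := map_mx i r in rj leg *; set Xi := map_mx i X in uX rj G *.
have uXS : X \in unitmx by rewrite -(map_unitmx i).
have uY : map_mx j X \in unitmx by rewrite map_unitmx.
set rj' := map_mx j r in rj; set Y := map_mx j X in rj uY G *.
have legj : ((1%:M : 'M_n) *t (pid_mx m : 'M_n)) *m rj' *m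
    ((1%:M : 'M_n) *t (copid_mx m : 'M_n)) = 0.
  (* The truncation matrices have entries 0 and 1, so the equation descends along [i] and can then
     be moved by [j]. *)
  have legS : ((1%:M : 'M_n) *t (pid_mx m : 'M_n)) *m r *m
      ((1%:M : 'M_n) *t (copid_mx m : 'M_n)) = 0.
    apply: (@map_mx_inj _ _ i); rewrite !map_mxM !map_mxT map_mx0 -/ri.
    by rewrite map_mx1 map_pid_mx map_copid_mx.
  move/(congr1 (map_mx j)): legS; rewrite !map_mxM !map_mxT map_mx0 -/rj'.
  by rewrite map_mx1 map_pid_mx map_copid_mx.
have uG : G \in unitmx by rewrite unitmx_mul unitmx_tr uY.
have rjE : (G^T *t G^T) *m rj' = (flip ri)^T *m (G^T *t G^T).
  have Vtens (M : 'M[L]_n) : M \in unitmx -> (invmx M *t invmx M) *m (M *t M) = 1%:M.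
    by move=> uM; rewrite tensmx_mul mulVmx // tensmx11.
  have e := rj; rewrite flip_Ad2 !Ad2E !trmx_mul !trmx_tens in e.
  have -> : G^T = Xi^T *m Y by rewrite trmx_mul trmxK.
  rewrite -!tensmx_mul -!mulmxA.
  have -> : (Y *t Y) *m rj' =
     ((invmx Xi)^T *t (invmx Xi)^T) *m ((flip ri)^T *m (Xi^T *t Xi^T)) *m (Y *t Y).
    by rewrite -e -!mulmxA Vtens // mulmx1.
  rewrite !mulmxA tensmx_mul -trmx_mul mulVmx // trmx1 tensmx11.
  by rewrite mul1mx.
clearbody G.
have cancel : ((1%:M : 'M_n) *t ((pid_mx m : 'M_n) *m invmx G^T)) *m (flip ri)^T *m
    ((1%:M : 'M_n) *t (G^T *m copid_mx m)) = 0.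
  have uGT : G^T \in unitmx by rewrite unitmx_tr.
  have -> : (flip ri)^T = (G^T *t G^T) *m rj' *m (invmx G^T *t invmx G^T).
    by rewrite rjE -mulmxA tensmx_mul mulmxV // tensmx11 mulmx1.
  transitivity ((G^T *t (1%:M : 'M_n)) *m (((1%:M : 'M_n) *t (pid_mx m : 'M_n)) *m rj' *m
    ((1%:M : 'M_n) *t (copid_mx m : 'M_n))) *m (invmx G^T *t (1%:M : 'M_n))); last first.
    by rewrite legj mulmx0 mul0mx.
  by rewrite !mul_tens_tens !mul1mx !mulmx1 mulKmx // mulmxKV.
have tr_pid : (pid_mx m : 'M[L]_n)^T = pid_mx m by rewrite tr_pid_mx.
have tr_copid : (copid_mx m : 'M[L]_n)^T = copid_mx m.
  by rewrite linearB /= trmx1 tr_pid.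
(* Transposition passes to the annihilator, and [flip] exchanges right legs with left legs. *)
move/(congr1 (fun M => flip M^T)): cancel.
rewrite !trmx_mul !trmx_tens !trmx_mul !trmxK trmx_inv trmxK tr_pid tr_copid trmx1.
by rewrite trmx0 linear0 !flipM flipK !flip_tens mulmxA.
Qed.

Lemma natr_neq0 (F : fieldType) (K : fieldExtType F) (L : fieldType)
    (iota : {rmorphism K -> L}) m :
  [pchar F] =i pred0 -> (0 < m)%N -> m%:R != 0 :> L.
Proof.
move=> /pcharf0P charF m0; rewrite -(rmorph_nat iota) fmorph_eq0.
by rewrite -(rmorph_nat (in_alg K)) fmorph_eq0 charF -lt0n.
Qed.

(** The only other possible value is [sqrtd] itself, and then [sigma] would fix all polynomials in
    [sqrtd], that is, all of [K]. *)
Lemma gal_sqrt (F : fieldType) (K : splittingFieldType F) (d : F) (sqrtd : K)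
    (sigma : gal_of {:K}) :
  sqrtd ^+ 2 = d%:A -> <<1; sqrtd>>%VS = {:K}%VS ->
  sigma \in 'Gal({:K} / 1)%g -> sigma != 1%g -> sigma sqrtd = - sqrtd.
Proof.
move=> sqrtdE K_gen sG s1.
have fix_base (c : F) : sigma c%:A = c%:A.
  by apply: (fixed_gal (sub1v _) sG); rewrite rpredZ // rpred1.
have : sigma sqrtd ^+ 2 = sqrtd ^+ 2 by rewrite -rmorphXn sqrtdE /= fix_base.
move/eqP; rewrite eqf_sqr => /orP[/eqP fixd|/eqP//].
case/negP: s1; apply/eqP/eqP/gal_eqP => u _; rewrite gal_id.
have /Fadjoin_polyP[p p1 ->] : u \in <<1; sqrtd>>%VS by rewrite K_gen memvf.
rewrite -horner_map /= fixd; congr (_.[_]).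
apply/polyP => k; rewrite coef_map /=.
by have /vlineP[c ->] := polyOverP p1 k; rewrite fix_base.
Qed.

Theorem proposition7p1
  (F : fieldType) (charF : [pchar F] =i pred0)
  (d : F) (d_neq0 : d != 0) (d_nonsquare : forall x : F, x ^+ 2 != d)
  (K : splittingFieldType F) (sqrtd : K) (sqrtdE : sqrtd ^+ 2 = d%:A)
  (K_gen : <<1; sqrtd>>%VS = {:K}%VS)
  (Fbar : closedFieldType) (iota : {rmorphism K -> Fbar})
  (Fbar_alg : forall x : Fbar, algebraicOver (fun a : F => iota a%:A) x)
  (sigma : gal_of {:K}) (sigma_gal : sigma \in 'Gal({:K} / 1)%g)
  (sigma_neq1 : sigma != 1%g)
  (n : nat) (n_gt0 : (0 < n)%N)
  (d' : F) (d'_neq0 : d' != 0)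
  (sqrtd' : Fbar) (sqrtd'E : sqrtd' ^+ 2 = iota d'%:A)
  (sqrtd'_notin_K : forall y : K, iota y != sqrtd')
  (X : 'M[Fbar]_n) (X_unit : X \in unitmx)
  (G1 G2 : {set 'I_n.-1}) (tau : 'I_n.-1 -> 'I_n.-1)
  (rBD : 'M[Fbar]_(n * n)) (rBD_BD : BD_rmatrix G1 G2 tau rBD)
  (bialg : coboundary_bialgebra (su_in sigma iota) (sqrtd' *: Ad2 X rBD)) :
  G1 = set0 /\ G2 = set0.
Proof.
have n0 : n%:R != 0 :> Fbar := natr_neq0 iota charF n_gt0.
have two0 : 2%:R != 0 :> Fbar := natr_neq0 iota (m := 2) charF isT.
have s_sqrtd := gal_sqrt sqrtdE K_gen sigma_gal sigma_neq1.
have fix_base (c : F) : sigma c%:A = c%:A.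
  by apply: (fixed_gal (sub1v _) sigma_gal); rewrite rpredZ // rpred1.
have algK x : algebraicOver iota x.
  have [p p0 px] := Fbar_alg x; exists (map_poly (in_alg K) p).
    by rewrite map_poly_eq0.
  by rewrite -map_poly_comp.
pose iotas : {rmorphism K -> Fbar} := iota \o sigma.
pose p : {poly K} := 'X^2 - (d'%:A)%:P.
(* Since [sigma] fixes $d'$, both embeddings give [p] the roots $\pm\sqrt{d'}$; [p] is minimal
   because $\sqrt{d'}\notin K$. *)
have [S1 [k1 [i1 [j1 [ik1 jk1 [v i1v j1v]]]]]] : exists (S' : fieldType)
    (k : {rmorphism K -> S'}) (i' j' : {rmorphism S' -> Fbar}),
  [/\ i' \o k =1 iota, j' \o k =1 iotas & exists2 v, i' v = sqrtd' & j' v = - sqrtd'].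
  have map_p (f : {rmorphism K -> Fbar}) : map_poly f p = 'X^2 - (f d'%:A)%:P.
    by rewrite /p rmorphB /= map_polyXn map_polyC.
  apply: (@adjoin_root _ _ _ _ _ _ p).
  - by rewrite -size_poly_gt0 size_XnsubC.
  - by rewrite map_p /root !hornerE sqrtd'E subrr.
  - by rewrite map_p /root !hornerE sqrrN sqrtd'E /= fix_base subrr.
  - by move=> q q0 qs; rewrite size_XnsubC // (size_minpoly_sqrt sqrtd'_notin_K).
(* With these entries in the image of [i], both [X] and [rBD] descend to [S]. *)
pose xs := [seq X ab.1 ab.2 | ab <- enum {: 'I_n * 'I_n}] ++
  [seq rBD ab.1 ab.2 | ab <- enum {: 'I_(n * n) * 'I_(n * n)}].
have [|S [k [i [j [ik jk im]]]]] := @extend_embedding Fbar xs S1 i1 j1.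
  move=> z; have [q q0 qz] := algK z; exists (map_poly k1 q).
    by rewrite map_poly_eq0.
  by rewrite -map_poly_comp (eq_map_poly ik1).
have [X' XE] : exists X', X = map_mx i X'.
  apply: mx_preimage => a b; apply: im; rewrite mem_cat; apply/orP; left.
  by apply/mapP; exists (a, b); rewrite ?mem_enum.
have [r rE] : exists r, rBD = map_mx i r.
  apply: mx_preimage => a b; apply: im; rewrite mem_cat; apply/orP; right.
  by apply/mapP; exists (a, b); rewrite ?mem_enum.
pose kap : {rmorphism K -> S} := k \o k1.
have ikap y : i (kap y) = iota y by rewrite -ik1 -[LHS]/((i \o k) (k1 y)) ik.
have jkap y : j (kap y) = iota (sigma y).
  by rewrite -[RHS]/(iotas y) -jk1 -[LHS]/((j \o k) (k1 y)) jk.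
pose s : S := k v.
have is_ : i s = sqrtd' by rewrite -i1v -[LHS]/((i \o k) v) ik.
have js : j s = - i s by rewrite is_ -j1v -[LHS]/((j \o k) v) jk.
have s0 : sqrtd' != 0 by rewrite -(rmorph0 iota) eq_sym.
have mx_ikap (A : 'M[K]_n) : map_mx i (map_mx kap A) = map_mx iota A.
  by rewrite -map_mx_comp; apply: eq_map_mx.
have mx_jkap (A : 'M[K]_n) : map_mx j (map_mx kap A) = map_mx iota (map_mx sigma A).
  by rewrite -!map_mx_comp; apply: eq_map_mx.
have anti_su (A : 'M[K]_n) : su sigma A -> anti i j (map_mx kap A).
  case=> _ /eqP; rewrite addr_eq0 => /eqP sA; rewrite /anti mx_ikap mx_jkap.
  have -> : map_mx iota A = - (map_mx iota (map_mx sigma A))^T.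
    by rewrite map_trmx sA raddfN opprK.
  by rewrite linearN /= trmxK opprK.
set M := Ad2 X rBD in bialg.
have RE : map_mx i (s *: Ad2 X' r) = sqrtd' *: M.
  by rewrite map_mxZ is_ map_Ad2 -XE -rE.
have comm_su (A : 'M[K]_n) : su sigma A ->
    comm_mx (map_mx j (s *: Ad2 X' r) - (map_mx i (s *: Ad2 X' r))^T)
      (coprod (map_mx iota (map_mx sigma A))).
  move=> suA; rewrite -mx_jkap; apply: comm_conjugate_defect; first exact: anti_su.
  rewrite RE mx_ikap; have [|m [a [b [Va Vb e]]]] := bialg (map_mx iota A).
    by exists A.
  by exists m, a, b; split=> // x; [have [B suB ->] := Va x | have [B suB ->] := Vb x];
    exists (map_mx kap B); rewrite ?mx_ikap //; apply: anti_su.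
have Rj : map_mx j (s *: Ad2 X' r) = - (flip (map_mx i (s *: Ad2 X' r)))^T.
  apply: (conjugate_rmatrix n0 two0 js).
    rewrite RE is_ linearZ /= -scalerDr /M flip_Ad2 -linearD /=.
    by rewrite (BD_symmetric_part n0 rBD_BD) Ad2_casimir.
  move=> p' q'; set N := _ - _; rewrite -/N in comm_su.
  (* [B] is fixed by [sigma], so [B - B^T] and [sqrtd *: (B + B^T)] lie in [su]. Over [Fbar] they
     recover [B], which extends commutation from [su] to [sl]. *)
  pose B : 'M[K]_n := traceless (delta_mx p' q').
  have nK : n%:R != 0 :> K by rewrite -(fmorph_eq0 iota) rmorph_nat.
  have sqrtd0 : sqrtd != 0.
    apply: contraNneq d_neq0 => sd0; move: sqrtdE; rewrite sd0 expr0n /= => /esym/eqP.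
    by rewrite scaler_eq0 oner_eq0 orbF.
  have trB : \tr B = 0 := tr_traceless _ nK.
  have sB : map_mx sigma B = B.
    rewrite /B /traceless map_mxB map_delta_mx map_scalar_mx /=.
    by rewrite fmorph_div rmorph_nat -trace_map_mx map_delta_mx.
  have iB : map_mx iota B = traceless (delta_mx p' q').
    rewrite /B /traceless map_mxB map_delta_mx map_scalar_mx /=.
    by rewrite fmorph_div rmorph_nat -trace_map_mx map_delta_mx.
  have c1 : comm_mx N (coprod (map_mx iota (B - B^T))).
    have := comm_su (B - B^T); rewrite map_mxB -map_trmx sB; apply.
    split; first by rewrite linearB /= mxtrace_tr subrr.
    by rewrite map_mxB -map_trmx sB linearB /= trmxK addrC addrA subrK subrr.
  have c2 : comm_mx N (coprod (map_mx iota (sqrtd *: (B + B^T)))).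
    set V := sqrtd *: (B + B^T).
    have sV : map_mx sigma V = - V.
      by rewrite map_mxZ map_mxD -map_trmx sB /= s_sqrtd scaleNr.
    have suV : su sigma V.
      split; first by rewrite linearZ linearD /= mxtrace_tr trB addr0 mulr0.
      by rewrite sV linearN /= linearZ linearD /= trmxK [B^T + B]addrC addNr.
    have := comm_mxN (comm_su V suV).
    by rewrite sV raddfN -[- map_mx iota V]scaleN1r coprodZ scaleN1r opprK.
  have -> : traceless (delta_mx p' q') =
      2%:R^-1 *: (map_mx iota (B - B^T) + (iota sqrtd)^-1 *: map_mx iota (sqrtd *: (B + B^T))).
    rewrite -iB map_mxZ scalerA mulVf ?fmorph_eq0 // scale1r -map_mxD.
    by rewrite addrACA addNr addr0 -mulr2n -scaler_nat map_mxZ /= rmorph_nat scalerA mulVf // scale1r.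
  have comm_mxZ c (Y Z : 'M[Fbar]_(n * n)) : comm_mx Y Z -> comm_mx Y (c *: Z).
    by rewrite /comm_mx -scalemxAl -scalemxAr => ->.
  by rewrite coprodZ coprodD coprodZ; apply/comm_mxZ/comm_mxD/comm_mxZ.
(* The sign in [Rj] cancels against [j s = - i s]. *)
have AdE : Ad2 (map_mx j X') (map_mx j r) = (flip (Ad2 X rBD))^T.
  apply: (scalerI (a := - sqrtd')); first by rewrite oppr_eq0.
  rewrite -is_ -js -map_Ad2 -map_mxZ Rj RE linearZ /= linearZ /=.
  by rewrite js is_ scaleNr.
have [adm [r0 [theta [[r0C _ _] isoT rBDE]]]] := rBD_BD.
(* For [t] in [G2] but not in [G1], the transported subspace is preserved by every [e_pos] and by
   [e_neg t], which is impossible. *)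
have sub : G2 \subset G1.
  apply/subsetP => t; apply: contraLR => tG1; apply/negP => tG2.
  have leg := BD_right_leg isoT adm r0C tG1.
  rewrite -rBDE rE in leg; rewrite XE rE in AdE.
  have uX' : map_mx i X' \in unitmx by rewrite -XE.
  have := transported_leg uX' AdE leg.
  rewrite -rE rBDE => CD.
  apply: (upper_invariant_subspace _ (e_pos_eq0 isoT adm r0C CD)).
    by rewrite unitmx_mul unitmx_tr !map_unitmx -(map_unitmx i) uX'.
  move: tG2; rewrite -(adm_img adm) => /imsetP[a aG ta].
  by have := e_neg_eq0 isoT adm r0C CD aG; rewrite -ta.
have eqG : G2 = G1.
  apply/eqP; rewrite eqEcard sub -(adm_img adm) card_in_imset ?leqnn //.
  exact: adm_inj adm.
suff G10 : G1 = set0 by rewrite eqG.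
apply/setP => a; rewrite inE; apply/negP => aG.
have [l] := adm_nilp adm aG; case/negP.
(* [tau] maps [G1] onto itself, so no iterate ever leaves it. *)
elim: l => //= l IH; rewrite -eqG -(adm_img adm).
exact: imset_f.
Qed.
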